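(* Let $\mathbb{X}$ be $\mathbb{Z}^d$ ($d\in\mathbb{N}$) or $\mathbb{Z}^{\mathbb{N}}$, let $\mathcal{A}$ be a unital Banach algebra, let $a>0$ and $0<b<1$, let $\{p_n\}_{n\in\mathbb{N}}$ be a decreasing sequence and $\{q_n\}_{n\in\mathbb{N}}$ an increasing sequence in $(0,1]$, and let $p$ be such that $0<q_n\le p\le p_n\le1$ for all $n\in\mathbb{N}$. Then, with $\mathcal{S}^{\{p_n\}}(\mathbb{X},\mathcal{A})=\bigcap_{n\in\mathbb{N}}\ell^{p_n}_{\omega_n}(\mathbb{X},\mathcal{A})$ and $\mathcal{E}^{\{q_n\}}(\mathbb{X},\mathcal{A})=\bigcup_{n\in\mathbb{N}}\ell^{q_n}_{\nu_n}(\mathbb{X},\mathcal{A})$, we have the following hierarchy of inverse-closed algebras: $$\mathcal{E}^{\{q_n\}}(\mathbb{X},\mathcal{A})\subset\ell^{p}_{\eta_{a,b}}(\mathbb{X},\mathcal{A})\subset\mathcal{S}^{\{p_n\}}(\mathbb{X},\mathcal{A})\subset\ell^{p_n}_{\omega_{s_n}}(\mathbb{X},\mathcal{A})\subset\ell^{p_1}_{\omega_{s_1}}(\mathbb{X},\mathcal{A})\subset\ell^1(\mathbb{X},\mathcal{A})$$ for all $n\in\mathbb{N}$ with $n-1<s_n\le n$.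
   Context: $\mathbb{N}$ is the set of positive integers; $\mathbb{Z}^{\mathbb{N}}$ is the additive group of all finitely supported sequences of integers; $|m|$ denotes the Euclidean norm of $m\in\mathbb{X}$. $\mathcal{A}$ is complex, not necessarily commutative, with norm $\|\cdot\|$ and unit $1_{\mathcal A}$. Weights on $\mathbb{X}$: $\omega_s(m)=(1+|m|)^s$ for $s\ge0$; $\nu_r(m)=e^{|m|/(r+1)}$ for $r\ge0$; $\eta_{a,b}(m)=e^{a|m|^b}$ for $a>0$, $0<b<1$. For $0<p\le1$ and a weight $\omega$ (a submultiplicative map $\omega:\mathbb{X}\to[1,\infty)$, i.e. $\omega(x+y)\le\omega(x)\omega(y)$), $\ell^p_\omega(\mathbb{X},\mathcal{A})=\{f:\mathbb{X}\to\mathcal{A}:\sum_{x\in\mathbb{X}}\|f(x)\|^p\omega(x)^p<\infty\}$, an algebra under convolution $(f\star g)(x)=\sum_y f(x-y)g(y)$ with unit $\delta_0$ ($\delta_0(\mathbf0)=1_{\mathcal A}$, zero elsewhere); $\ell^1(\mathbb{X},\mathcal{A})$ is the case $p=1$, $\omega\equiv1$. Monotone sequences need not be strictly monotone. A subalgebra $\mathcal{X}$ of $\ell^1(\mathbb{X},\mathcal{A})$ is inverse-closed if every $f\in\mathcal{X}$ that is invertible in $\ell^1(\mathbb{X},\mathcal{A})$ is also invertible in $\mathcal{X}$ (equivalently: if $f\in\mathcal{X}$ and the Fourier transform $\widehat f(z)=\sum_{x\in\mathbb{X}}f(x)z^x$ is invertible in $\mathcal{A}$ for all $z\in\mathbb{T}^d$,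 resp. all $z\in\mathbb{T}^\infty=\{(z_1,z_2,\dots):|z_i|=1\}$, then $f$ is invertible in $\mathcal{X}$). *)

(* Defs.v *)
From HB Require Import structures.
From mathcomp Require Import all_boot all_order all_algebra.
From mathcomp Require Import finmap.
From mathcomp Require Import all_classical all_reals all_analysis.
From mathcomp Require Import complex.
From mathcomp Require summability.
From mathcomp Require Import -(notations) monalg.

Set Implicit Arguments.
Unset Strict Implicit.
Unset Printing Implicit Defensive.
Import Order.TTheory GRing.Theory Num.Theory numFieldNormedType.Exports.
Local Open Scope classical_set_scope.
Local Open Scope ring_scope.

(* Unital, associative, not necessarily commutative. The product is a field of
   its own rather than the one of an algType: Hierarchy Builder rejects a join
   of NormedModule with the ring structures, since NumDomain already inherits
   from both. The normalization `|bone| = 1 is not required. *)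
HB.mixin Record NormedModule_isBanachAlgebra (K : numFieldType) A
    & CompleteNormedModule K A := {
  bone : A;
  bmul : A -> A -> A;
  bmulA : associative bmul;
  bmul1l : left_id bone bmul;
  bmul1r : right_id bone bmul;
  bmulDl : left_distributive bmul +%R;
  bmulDr : right_distributive bmul +%R;
  bscaleAl : forall (k : K) (x y : A), k *: bmul x y = bmul (k *: x) y;
  bscaleAr : forall (k : K) (x y : A), k *: bmul x y = bmul x (k *: y);
  bnormM : forall x y : A, `|bmul x y| <= `|x| * `|y|
}.

#[short(type="banachAlgType")]
HB.structure Definition BanachAlgebra (K : numFieldType) :=
  {A of NormedModule_isBanachAlgebra K A & CompleteNormedModule K A}.

Variant lattice_rank := FiniteRank of nat | CountableRank.

Definition positive_rank (D : lattice_rank) : bool :=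
  if D is FiniteRank d then (0 < d)%N else true.

(* Z^d, or the finitely supported sequences of integers: [malg nat int] is the
   additive group of finitely supported functions from nat to int. *)
Definition lattice (D : lattice_rank) : zmodType :=
  match D with
  | FiniteRank d => 'rV[int]_d
  | CountableRank => monalg.malg nat int
  end.

Definition euclid (R : realType) (D : lattice_rank) : lattice D -> R :=
  match D return lattice D -> R with
  | FiniteRank d => fun m : 'rV[int]_d =>
      Num.sqrt (\sum_(i < d) (m ord0 i)%:~R ^+ 2)
  | CountableRank => fun m : monalg.malg nat int =>
      Num.sqrt (\sum_(i <- monalg.msupp m) (monalg.mcoeff i m)%:~R ^+ 2)
  end.

Section Weights.
Context {R : realType} {D : lattice_rank}.

Definition omega_weight (s : R) (m : lattice D) : R := (1 + euclid R m) `^ s.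

Definition nu_weight (r : R) (m : lattice D) : R := expR (euclid R m / (r + 1)).

Definition eta_weight (a b : R) (m : lattice D) : R := expR (a * euclid R m `^ b).

End Weights.

Section Spaces.
Context {R : realType} (D : lattice_rank) (A : banachAlgType R[i]).
Local Notation X := (lattice D).

(* The norm of a normed module over R[i] takes its values in R[i] (in fact in
   the nonnegative reals); this is the same norm, valued in R. *)
Definition rnorm (x : A) : R := complex.Re `|x|.

Definition ell (p : R) (w : X -> R) : set (X -> A) :=
  [set f | (\esum_(x in [set: X]) (rnorm (f x) `^ p * w x `^ p)%:E < +oo)%E].

Definition ell1 : set (X -> A) := ell 1 (fun=> 1).

(* [summability.sum] is the unordered sum: the limit of the finite partial sums
   along the finite subsets of X ordered by inclusion. *)
Definition conv (f g : X -> A) : X -> A :=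
  fun x => summability.sum (fun y => bmul (f (x - y)) (g y)).

Definition delta0 : X -> A := fun x => if x == 0 then bone else 0.

Definition invertible_in (S : set (X -> A)) (f : X -> A) : Prop :=
  exists2 g, S g & conv f g = delta0 /\ conv g f = delta0.

Definition subalgebra (S : set (X -> A)) : Prop :=
  [/\ S `<=` ell1,
      S delta0,
      forall f g, S f -> S g -> S (fun x => f x + g x),
      forall (c : R[i]) f, S f -> S (fun x => c *: f x) &
      forall f g, S f -> S g -> S (conv f g)].

Definition inverse_closed (S : set (X -> A)) : Prop :=
  subalgebra S /\
  forall f, S f -> invertible_in ell1 f -> invertible_in S f.

(* Sequences indexed by the positive integers are functions on nat whose value
   at 0 is never used. *)
Definition S_space (p_ : nat -> R) : set (X -> A) :=
  \bigcap_(n in [set n | (0 < n)%N]) ell (p_ n) (omega_weight n%:R).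

Definition E_space (q_ : nat -> R) : set (X -> A) :=
  \bigcup_(n in [set n | (0 < n)%N]) ell (q_ n) (nu_weight n%:R).

End Spaces.

Arguments ell {R} D A p w.
Arguments ell1 {R} D A.
Arguments S_space {R} D A p_.
Arguments E_space {R} D A q_.

(* Main.v *)
(* Let g be the inverse of f in ell^1. Cut g to a finite set J, g = h + k, and put
   u = delta - f * h = f * k, whose ell^1 norm is as small as we like. Since
   g * f = delta we get g = h + g * u, where only the finitely supported h is
   moved across a product, so no Fubini theorem in A is needed. Taking norms,
   |g| <= |h| + |g| * |u|, an inequality between scalar functions, hence
   |g| <= sum_n |h| * |u|^n, and it remains to sum this series in the weighted
   p-norm. Write |u| = u0 + u1 with u0 of finite support and u1 small in the
   weighted p-norm. The support of |h| * u0^n has polynomially many points, all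
   of Euclidean norm O(n), so a weight of subexponential growth costs only a
   factor O(2^n), while the values are at most |h|_1 |u0|_1^n; the mixed terms
   are controlled because convolutions by u0 and by |u| commute. For the union
   of exponentially weighted spaces, the weight in which the series is summed is
   chosen after the support of u0. *)
Require Import Defs.
From HB Require Import structures.
From mathcomp Require Import all_boot all_order all_algebra.
From mathcomp Require Import finmap.
From mathcomp Require Import all_classical all_reals all_analysis.
From mathcomp Require Import complex.
From mathcomp Require summability.
From mathcomp Require Import ring lra.
From mathcomp Require Import -(notations) monalg.
Set Implicit Arguments.
Unset Strict Implicit.
Unset Printing Implicit Defensive.
Import Order.TTheory GRing.Theory Num.Theory numFieldNormedType.Exports.
Local Open Scope classical_set_scope.
Local Open Scope ring_scope.

Local Notation conv := Defs.conv.
Local Notation delta0 := (Defs.delta0 _).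

(** * Unordered sums of nonnegative extended reals *)

Section PowerSums.
Context {R : realType}.
Implicit Types (a b p r : R) (x y : \bar R).

(** Split (a + b)^p as the sum of (a + b)^p c / (a + b) over c = a, b. Each ratio c / (a + b) lies
    in [0, 1], so it is at most its own p-th power. *)
Lemma powRD_le p a b : 0 < p <= 1 -> 0 <= a -> 0 <= b ->
  (a + b) `^ p <= a `^ p + b `^ p.
Proof.
move=> /andP[p0 p1] a0 b0; have [s0|sN0] := eqVneq (a + b) 0.
  by rewrite s0 powR0 ?gt_eqF// addr_ge0 ?powR_ge0.
have s0 : 0 < a + b by rewrite lt_neqAle eq_sym sN0 addr_ge0.
have step c : 0 <= c -> c <= a + b -> (a + b) `^ p * (c / (a + b)) <= c `^ p.
  move=> c0 cs; rewrite -[in leRHS](divfK sN0 c) powRM ?divr_ge0 ?(ltW s0)//.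
  rewrite [leRHS]mulrC ler_wpM2l ?powR_ge0//; have [->|cN0] := eqVneq c 0.
    by rewrite mul0r powR_ge0.
  by rewrite ger1_powR// divr_gt0 ?ler_pdivrMr ?mul1r// lt_neqAle eq_sym cN0.
rewrite -[leLHS]mulr1 -[X in _ * X](divff sN0) mulrDl mulrDr.
by rewrite lerD ?step ?lerDl ?lerDr.
Qed.

Lemma poweRD_le p x y : 0 < p <= 1 -> (0 <= x)%E -> (0 <= y)%E ->
  ((x + y) `^ p <= x `^ p + y `^ p)%E.
Proof.
move=> pp; have pN0 : p != 0 by case/andP: pp => ? _; rewrite gt_eqF.
case: x => [a| |]// a0; case: y => [b| |]// b0.
- by rewrite -EFinD !poweR_EFin -EFinD lee_fin powRD_le.
- by rewrite !poweRyr// addey// ?gt_eqF ?(lt_le_trans _ (poweR_ge0 _ _)).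
- by rewrite !poweRyr// addye// ?gt_eqF ?(lt_le_trans _ (poweR_ge0 _ _)).
- by rewrite addye// !poweRyr.
Qed.

Lemma le_poweR p x y : 0 <= p -> (0 <= x)%E -> (x <= y)%E ->
  (x `^ p <= y `^ p)%E.
Proof.
move=> p0 x0 xy; apply: gt0_ler_poweR => //; rewrite in_itv/= leey andbT//.
exact: le_trans xy.
Qed.

Lemma poweR_sum_le (T : Type) (s : seq T) (a : T -> \bar R) p :
  0 < p <= 1 -> (forall t, 0 <= a t)%E ->
  ((\sum_(t <- s) a t) `^ p <= \sum_(t <- s) a t `^ p)%E.
Proof.
move=> pp a0; have pN0 : p != 0 by case/andP: pp => ? _; rewrite gt_eqF.
elim: s => [|t s IH]; first by rewrite !big_nil poweR0r.
rewrite !big_cons (le_trans (poweRD_le _ _ _))// ?sume_ge0//.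
by rewrite leeD2l.
Qed.

Lemma poweR_esum_le (T : choiceType) (a : T -> \bar R) p :
  0 < p <= 1 -> (forall t, 0 <= a t)%E ->
  ((\esum_(t in [set: T]) a t) `^ p <= \esum_(t in [set: T]) a t `^ p)%E.
Proof.
move=> pp a0; have /andP[p0 p1] := pp.
have pN0 : p != 0 by rewrite gt_eqF.
set S := esum _ _; set B := esum _ _.
have B0 : (0 <= B)%E by apply: esum_ge0 => t _; exact: poweR_ge0.
(* With both sides p-th powers, it remains to bound the supremum by B^(1/p), that is, to bound every
   finite partial sum. *)
have -> : B = ((B `^ p^-1) `^ p)%E by rewrite -poweRrM mulVf// poweRe1.
apply: le_poweR; [exact: ltW|exact: esum_ge0|].
apply: ge_ereal_sup => _ [J [finJ _]] <-.
rewrite -[leLHS]poweRe1 ?fsume_ge0// -(mulfV pN0) poweRrM.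
apply: le_poweR; [by rewrite invr_ge0 ltW|exact: poweR_ge0|].
rewrite fsbig_finite//= (le_trans (poweR_sum_le _ _ _))//.
by apply: esum_ge; exists J => //; rewrite fsbig_finite.
Qed.

End PowerSums.

(** * Exchange, scaling and truncation of unordered sums *)

Section EsumExtra.
Context {R : realType}.
Implicit Types (T : choiceType).
Local Open Scope ereal_scope.

Lemma esum_exchange (T1 T2 : choiceType) (a : T1 -> T2 -> \bar R) :
  (forall i j, 0 <= a i j) ->
  \esum_(i in [set: T1]) \esum_(j in [set: T2]) a i j =
  \esum_(j in [set: T2]) \esum_(i in [set: T1]) a i j.
Proof.
move=> a0; rewrite !(@esum_esum _ _ _ setT (fun=> setT))//.
apply: (@reindex_esum _ _ _ _ _ (fun z : T2 * T1 => (z.2, z.1))).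
split => //=; first by move=> [? ?] [? ?] _ _ [-> ->].
by move=> [i j] _; exists (j, i).
Qed.

Lemma esum_ubound T (a : T -> \bar R) t : (forall t, 0 <= a t) ->
  a t <= \esum_(t in [set: T]) a t.
Proof.
move=> a0; apply: esum_ge; exists [set t]; last by rewrite fsbig_set1.
by split => //; exact: finite_set1.
Qed.

Lemma ge0_esumZl T (a : T -> \bar R) (c : \bar R) : 0 <= c ->
  (forall t, 0 <= a t) ->
  \esum_(t in [set: T]) (c * a t) = c * \esum_(t in [set: T]) a t.
Proof.
move=> c0 a0; have ca0 t : 0 <= c * a t by rewrite mule_ge0.
apply/eqP; rewrite eq_le; apply/andP; split.
  apply: ge_ereal_sup => _ [J [finJ _]] <-.
  rewrite fsbig_finite//= -ge0_sume_distrr//; apply: lee_wpmul2l => //.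
  by apply: esum_ge; exists J => //; rewrite fsbig_finite.
have [->|cN0] := eqVneq c 0; first by rewrite mul0e esum_ge0// => t _; rewrite mul0e.
have c_gt0 : 0 < c by rewrite lt0e cN0.
case: c c0 c_gt0 {cN0} ca0 => [r| |]// _ r0 ca0.
  rewrite -lee_pdivlMl//; apply: ge_ereal_sup => _ [J [finJ _]] <-.
  rewrite lee_pdivlMl// fsbig_finite//= ge0_sume_distrr//.
  by apply: esum_ge; exists J => //; rewrite fsbig_finite.
have [a_eq0|/existsNP[t /eqP aN0]] := pselect (forall t, a t = 0).
  by rewrite (esum1 (a := a))// mule0 esum_ge0.
have at_gt0 : 0 < a t by rewrite lt0e aN0 a0.
by apply: le_trans (esum_ubound t ca0); rewrite (gt0_mulye at_gt0) leey.
Qed.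

(** [J] nearly attains the supremum defining the sum, and its finite part can be subtracted because
    the total is finite. The first conclusion feeds a Cauchy criterion, the second makes truncation
    errors small. *)
Lemma esum_tail T (a : T -> \bar R) (e : R) : (0 < e)%R -> (forall t, 0 <= a t) ->
  \esum_(t in [set: T]) a t < +oo ->
  exists2 J : {fset T},
    \esum_(t in [set: T]) a t < \sum_(t <- J) a t + e%:E &
    \esum_(t in [set: T]) (if t \in J then 0 else a t) <= e%:E.
Proof.
move=> e0 a0 fin; set S := esum _ _ in fin *.
have Sfin : S \is a fin_num by rewrite ge0_fin_numE// esum_ge0.
have [_ [J [finJ _]] <- SJ] := ub_ereal_sup_adherent e0 Sfin.
have SJ' : S < \sum_(t <- fset_set J) a t + e%:E.
  by move: SJ; rewrite -[ereal_sup _]/S fsbig_finite//= -lteBlDr.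
exists (fset_set J) => //; have S' := SJ'; move: S'.
have -> : S = \sum_(t <- fset_set J) a t +
              \esum_(t in [set: T]) (if t \in fset_set J then 0 else a t).
  rewrite /S (esumID J)// setTI; congr (_ + _).
    by rewrite esum_fset// fsbig_finite.
  rewrite setTI esum_mkcond; apply: eq_esum => t _; rewrite in_fset_set//.
  by rewrite in_setC; case: (t \in J).
rewrite lteD2lE; first exact: ltW.
rewrite ge0_fin_numE ?sume_ge0//; apply: le_lt_trans fin.
by apply: esum_ge; exists J => //; rewrite fsbig_finite.
Qed.

End EsumExtra.

(** * Scalar convolution *)

Section Convolution.
Context {R : realType} {X : zmodType}.
Implicit Types (p : R) (w : X -> R) (f g v : X -> \bar R).
Local Open Scope ereal_scope.

(** The convolution f * v, with [v] first so that [econv v] is an operator and repeated convolution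
    by [v] is [iter n (econv v)]. *)
Definition econv v f : X -> \bar R :=
  fun x => \esum_(y in [set: X]) (f (x - y)%R * v y).

(* The p-th power of the weighted quasi-norm, [w] being the p-th power of the
   weight. *)
Definition wsum p w v : \bar R := \esum_(x in [set: X]) (v x `^ p * (w x)%:E).

Definition nonneg v := forall x, 0 <= v x.

Lemma econv_ge0 v f : nonneg v -> nonneg f -> nonneg (econv v f).
Proof. by move=> v0 f0 x; apply: esum_ge0 => y _; exact: mule_ge0. Qed.

Lemma iter_econv_ge0 n v f : nonneg v -> nonneg f -> nonneg (iter n (econv v) f).
Proof. by move=> v0 f0; elim: n => //= n IH; exact: econv_ge0. Qed.

Lemma le_econv v f g : nonneg v -> (forall x, f x <= g x) ->
  forall x, econv v f x <= econv v g x.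
Proof. by move=> v0 fg x; apply: le_esum => y _; exact: lee_wpmul2r. Qed.

Lemma econvDl v1 v2 f : nonneg v1 -> nonneg v2 -> nonneg f ->
  econv (v1 \+ v2) f = econv v1 f \+ econv v2 f.
Proof.
move=> v10 v20 f0; apply/funext => x; rewrite /econv/= -esumD => [|y _|y _]; last 2 first.
- exact: mule_ge0.
- exact: mule_ge0.
by apply: eq_esum => y _; rewrite ge0_muleDr.
Qed.

Lemma econvDr v f g : nonneg v -> nonneg f -> nonneg g ->
  econv v (f \+ g) = econv v f \+ econv v g.
Proof.
move=> v0 f0 g0; apply/funext => x; rewrite /econv/= -esumD => [|y _|y _]; last 2 first.
- exact: mule_ge0.
- exact: mule_ge0.
by apply: eq_esum => y _; rewrite ge0_muleDl.
Qed.

(* Commutation of the operators [econv v1] and [econv v2] is the only form in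
   which commutativity and associativity of the scalar convolution are used. *)
Lemma econvCA v1 v2 f : nonneg v1 -> nonneg v2 -> nonneg f ->
  econv v1 (econv v2 f) = econv v2 (econv v1 f).
Proof.
move=> v10 v20 f0; apply/funext => x.
have cnv2E u1 u2 : nonneg u1 -> nonneg u2 -> econv u1 (econv u2 f) x =
    \esum_(y in [set: X]) \esum_(z in [set: X]) (u1 y * (u2 z * f (x - y - z)%R)).
  move=> u10 u20; apply: eq_esum => y _; rewrite muleC -ge0_esumZl//.
    by apply: eq_esum => z _; rewrite (muleC (f _)).
  by move=> z; exact: mule_ge0.
rewrite !cnv2E// esum_exchange; last by move=> y z; rewrite !mule_ge0.
apply: eq_esum => y _; apply: eq_esum => z _.
by rewrite muleCA addrAC.
Qed.

Lemma iter_econvD n v f g : nonneg v -> nonneg f -> nonneg g ->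
  iter n (econv v) (f \+ g) = iter n (econv v) f \+ iter n (econv v) g.
Proof.
move=> v0 f0 g0; elim: n => //= n ->.
by rewrite econvDr//; exact: iter_econv_ge0.
Qed.

Lemma le_iter_econv n v f g : nonneg v -> (forall x, f x <= g x) ->
  forall x, iter n (econv v) f x <= iter n (econv v) g x.
Proof. by move=> v0 fg; elim: n => //= n IH; exact: le_econv. Qed.

Lemma econv_iterC n v1 v2 f : nonneg v1 -> nonneg v2 -> nonneg f ->
  econv v1 (iter n (econv v2) f) = iter n (econv v2) (econv v1 f).
Proof.
move=> v10 v20 f0; elim: n => //= n <-.
by rewrite econvCA//; exact: iter_econv_ge0.
Qed.

Lemma esum_translate v y :
  \esum_(x in [set: X]) v (x - y)%R = \esum_(x in [set: X]) v x.
Proof.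
symmetry; apply: (@reindex_esum _ _ _ _ _ (fun x => (x - y)%R)).
split => //=; first by move=> x z _ _ /addIr.
by move=> x _; exists (x + y)%R => //; rewrite addrK.
Qed.

Lemma wsum_ge0 p w v : (forall x, (0 <= w x)%R) -> 0 <= wsum p w v.
Proof.
by move=> w0; apply: esum_ge0 => x _; rewrite mule_ge0 ?poweR_ge0 ?lee_fin.
Qed.

Lemma le_wsum p w v f : (0 <= p)%R -> (forall x, (0 <= w x)%R) ->
  nonneg v -> (forall x, v x <= f x) -> wsum p w v <= wsum p w f.
Proof.
move=> p0 w0 v0 vf; apply: le_esum => x _; apply: lee_wpmul2r.
  by rewrite lee_fin.
exact: le_poweR.
Qed.

Lemma wsumD p w f g : (0 < p <= 1)%R -> (forall x, (0 <= w x)%R) ->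
  nonneg f -> nonneg g -> wsum p w (f \+ g) <= wsum p w f + wsum p w g.
Proof.
move=> pp w0 f0 g0; rewrite -esumD => [|y _|y _]; last 2 first.
- by rewrite mule_ge0 ?poweR_ge0 ?lee_fin.
- by rewrite mule_ge0 ?poweR_ge0 ?lee_fin.
apply: le_esum => y _; rewrite -ge0_muleDl ?poweR_ge0//.
by apply: lee_wpmul2r; rewrite ?lee_fin ?poweRD_le.
Qed.

Lemma wsum1 v : nonneg v -> wsum 1 (fun=> 1%R) v = \esum_(x in [set: X]) v x.
Proof. by move=> v0; apply: eq_esum => x _; rewrite poweRe1// mule1. Qed.

(** Subadditivity moves the p-th power inside the inner sum, the weight splits along x = (x - y) +
    y, and exchanging the two sums separates the factors. *)
Lemma wsum_econv p w v f : (0 < p <= 1)%R -> (forall x, (0 <= w x)%R) ->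
  (forall x y, (w (x + y) <= w x * w y)%R) -> nonneg v -> nonneg f ->
  wsum p w (econv v f) <= wsum p w v * wsum p w f.
Proof.
move=> pp w0 wM v0 f0.
pose phi u x : \bar R := u x `^ p * (w x)%:E.
have phi0 u x : 0 <= phi u x by rewrite mule_ge0 ?poweR_ge0 ?lee_fin.
have -> : wsum p w v * wsum p w f =
    \esum_(x in [set: X]) \esum_(y in [set: X]) (phi v y * phi f (x - y)%R).
  rewrite esum_exchange; last by move=> x y; rewrite mule_ge0.
  rewrite muleC -[wsum p w v]/(\esum_(y in [set: X]) phi v y).
  rewrite -ge0_esumZl//; last exact: wsum_ge0.
  apply: eq_esum => y _; rewrite ge0_esumZl// [RHS]muleC.
  by congr (_ * _); rewrite (esum_translate (phi f)).
apply: le_esum => x _; apply: (@le_trans _ _ ((w x)%:E *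
    \esum_(y in [set: X]) (f (x - y)%R `^ p * v y `^ p))).
  rewrite muleC; apply: lee_wpmul2l; rewrite ?lee_fin//.
  apply: (le_trans (poweR_esum_le _ _)) => // [y|]; first exact: mule_ge0.
  by apply: le_esum => y _; rewrite poweRM.
rewrite -ge0_esumZl ?lee_fin//; last by move=> y; rewrite mule_ge0 ?poweR_ge0.
apply: le_esum => y _.
rewrite /phi [leRHS]muleACA [leRHS]muleC (muleC (v y `^ p)).
apply: lee_wpmul2r; first by rewrite mule_ge0 ?poweR_ge0.
by rewrite -EFinM lee_fin mulrC -{1}(subrK y x).
Qed.

Lemma esum_econv v f : nonneg v -> nonneg f ->
  \esum_(x in [set: X]) econv v f x <=
  (\esum_(x in [set: X]) v x) * \esum_(x in [set: X]) f x.
Proof.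
move=> v0 f0; rewrite -!wsum1//; last exact: econv_ge0.
by apply: wsum_econv => //; rewrite ?ltr01 ?lexx// => x y; rewrite mulr1.
Qed.

Lemma esum_iter_econv n v f (c : R) : nonneg v -> nonneg f ->
  \esum_(x in [set: X]) v x <= c%:E ->
  \esum_(x in [set: X]) iter n (econv v) f x <=
  (c ^+ n)%:E * \esum_(x in [set: X]) f x.
Proof.
move=> v0 f0 vc.
have c0 : (0 <= c)%R by rewrite -lee_fin (le_trans _ vc)// esum_ge0.
elim: n => [|n IH] /=; first by rewrite expr0 mul1e.
apply: (le_trans (esum_econv _ _)) => //; first exact: iter_econv_ge0.
rewrite exprS EFinM -muleA; apply: lee_pmul => //; apply: esum_ge0 => x _ //.
exact: iter_econv_ge0.
Qed.

Lemma wsum_series p w (F : nat -> X -> \bar R) : (0 < p <= 1)%R ->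
  (forall x, (0 <= w x)%R) -> (forall k, nonneg (F k)) ->
  wsum p w (fun x => \sum_(k <oo) F k x) <= \sum_(k <oo) wsum p w (F k).
Proof.
move=> pp w0 F0; rewrite nneseries_esumT; last by move=> k; exact: wsum_ge0.
rewrite esum_exchange; last by move=> k x; rewrite mule_ge0 ?poweR_ge0 ?lee_fin.
apply: le_esum => x _; rewrite nneseries_esumT; last by move=> k; exact: F0.
apply: (@le_trans _ _ ((w x)%:E * \esum_(k in [set: nat]) (F k x `^ p))).
  rewrite muleC; apply: lee_wpmul2l; rewrite ?lee_fin//.
  by apply: poweR_esum_le => // k; exact: F0.
rewrite -ge0_esumZl ?lee_fin//; last by move=> k; exact: poweR_ge0.
by apply: le_esum => k _; rewrite muleC.
Qed.

(** Iterating the inequality n times leaves the remainder [iter n (econv v) g], whose sum is at most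
    2^-n times that of [g]. A value is bounded by the total sum, so the remainder tends to 0
    pointwise. *)
Lemma neumann_le v f g : nonneg v -> nonneg f -> nonneg g ->
  (forall x, g x <= f x + econv v g x) ->
  \esum_(x in [set: X]) v x <= (2^-1)%:E ->
  \esum_(x in [set: X]) g x < +oo ->
  forall x, g x <= \sum_(k <oo) iter k (econv v) f x.
Proof.
move=> v0 f0 g0 gfg v12 gfin x.
have it k : 0 <= iter k (econv v) f x by exact: iter_econv_ge0.
have step n : g x <= \sum_(0 <= k < n) iter k (econv v) f x + iter n (econv v) g x.
  elim: n => [|n IH]; first by rewrite big_geq// add0e.
  rewrite big_nat_recr//= (le_trans IH)// -addeA leeD2l//.
  rewrite econv_iterC// -[leRHS]/((iter n (econv v) f \+ _) x) -iter_econvD//.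
    exact: le_iter_econv.
  exact: econv_ge0.
set L := esum _ _ in gfin.
have L0 : 0 <= L by apply: esum_ge0.
have Lfin : L = (fine L)%:E by rewrite fineK// ge0_fin_numE.
apply/lee_addgt0Pr => e e0.
have [n Ln] : exists n, (fine L * 2^-1 ^+ n <= e)%R.
  have [n Ln] : exists n, (fine L / e < n%:R)%R.
    exists (Num.bound (fine L / e)); apply: le_lt_trans (archi_boundP _).
      by [].
    by rewrite divr_ge0 ?fine_ge0// ltW.
  exists n; rewrite exprVn ler_pdivrMr ?exprn_gt0// mulrC -ler_pdivrMr//.
  by rewrite (le_trans (ltW Ln))// -natrX ler_nat ltnW// ltn_expl.
apply: (le_trans (step n)); apply: leeD.
  exact: nneseries_lim_ge.
apply: (le_trans (esum_ubound x (iter_econv_ge0 n v0 g0))).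
apply: (le_trans (esum_iter_econv n v0 g0 v12)).
by rewrite -/L Lfin -EFinM lee_fin mulrC.
Qed.

End Convolution.

(** * Neumann series in weighted p-norms *)

Section Neumann.
Context {R : realType} {X : zmodType} (E : X -> R).
Hypothesis ED : forall x y, E (x + y) <= E x + E y.
Implicit Types (p c C M : R) (w : X -> R) (f g v : X -> \bar R) (F H : seq X).
Local Open Scope ereal_scope.

Lemma wsum_fin_le p w v (L : seq X) (c : \bar R) (d : R) :
  (0 < p)%R -> (forall x, (0 <= w x)%R) -> nonneg v -> 0 <= c -> (0 <= d)%R ->
  (forall x, v x != 0 -> [/\ x \in L, v x <= c & (w x <= d)%R]) ->
  wsum p w v <= (size L)%:R%:E * (c `^ p * d%:E).
Proof.
move=> p0 w0 v0 c0 d0 vL; set K := c `^ p * d%:E.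
have K0 : 0 <= K by rewrite mule_ge0 ?poweR_ge0 ?lee_fin.
(* The constant is spread over [L] as a sum of indicators of its entries. Repetitions in [L] only
   enlarge this sum, and each point of the support receives at least one copy of [K]. *)
have -> : (size L)%:R%:E * K = \esum_(x in [set: X])
    (\sum_(y <- L) (if x \in [set y] then K else 0)).
  rewrite esum_sum; last by move=> x y _ _; case: ifP.
  rewrite (eq_bigr (fun=> K)) => [|y _]; last first.
    by rewrite -(esum_mkcond [set y] (fun=> K)) esum_set1.
  elim: L {vL} => [|y L IH]; first by rewrite big_nil mul0e.
  by rewrite big_cons -IH -natr1 EFinD ge0_muleDl ?lee_fin// mul1e addeC.
apply: le_esum => x _; have [vx0|vxN0] := eqVneq (v x) 0.
  rewrite vx0 poweR0r ?gt_eqF// mul0e sume_ge0// => y _.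
  by case: ifP.
have [xL vc wd] := vL _ vxN0.
rewrite (big_rem x)//= mem_set// -[leLHS]adde0; apply: leeD; last first.
  by apply: sume_ge0 => y _; case: ifP.
apply: lee_pmul; rewrite ?poweR_ge0 ?lee_fin//.
by apply: le_poweR => //; exact: ltW.
Qed.

(** One point of [H] plus multiples of points of [F], each multiplicity being at most k separately.
    This contains the support of the k-fold convolution, while its size is a polynomial in k of
    degree [size F]. *)
Definition combinations H F k : seq X :=
  [seq (h + \sum_(i < size F) F`_i *+ n i)%R | h : X <- H,
    n : {ffun 'I_(size F) -> 'I_k.+1} <- enum {ffun 'I_(size F) -> 'I_k.+1}].

Lemma size_combinations H F k :
  size (combinations H F k) = (size H * k.+1 ^ size F)%N.
Proof. by rewrite size_allpairs -cardE card_ffun !card_ord. Qed.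

(** A nonzero value of a convolution comes from a nonzero product, so each iteration adds one point
    of [F]. Subadditivity of [E] over one point of [H] and k points of [F] gives the factor k +
    1. *)
Lemma iter_econv_supp H F M v f k x :
  (forall y, v y != 0 -> y \in F) -> (forall y, f y != 0 -> y \in H) ->
  (forall y, y \in F -> (E y <= M)%R) -> (forall y, y \in H -> (E y <= M)%R) ->
  iter k (econv v) f x != 0 ->
  x \in combinations H F k /\ (E x <= M * k.+1%:R)%R.
Proof.
move=> vF fH FM HM xN0.
have [h hH [n [nk ->{x xN0} hE]]] : exists2 h, h \in H &
    exists n : 'I_(size F) -> nat, [/\ (\sum_i n i)%N = k,
      x = (h + \sum_(i < size F) F`_i *+ n i)%R & (E x <= M * k.+1%:R)%R].
  elim: k x xN0 => [|k IH] x /= xN0.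
    exists x; first exact: fH.
    exists (fun=> 0%N); split; [by rewrite big1| |by rewrite mulr1 HM// fH].
    by rewrite big1 ?addr0// => i _; rewrite mulr0n.
  have [y yN0] : exists y, iter k (econv v) f (x - y)%R * v y != 0.
    apply: contrapT => /forallNP y0; move/eqP: xN0; apply; apply: esum1 => y _.
    by apply/eqP/negPn/negP; exact: y0.
  have [kN0 /vF yF] : iter k (econv v) f (x - y)%R != 0 /\ v y != 0.
    by split; apply: contra_neq yN0 => ->; rewrite ?mul0e ?mule0.
  have [h hH [n [nk xy Exy]]] := IH _ kN0.
  have yF' : (index y F < size F)%N by rewrite index_mem.
  pose i0 := Ordinal yF'.
  exists h => //; exists (fun i => n i + if i == i0 then 1 else 0)%N; split.
  - by rewrite big_split/= nk -big_mkcond/= big_pred1_eq addn1.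
  - rewrite -[LHS](subrK y) xy -addrA; congr (_ + _)%R.
    under [RHS]eq_bigr do rewrite mulrnDr.
    rewrite big_split/=; congr (_ + _)%R.
    rewrite (eq_bigr (fun i => if i == i0 then F`_i else 0%R)); last first.
      by move=> i _; case: ifP.
    by rewrite -big_mkcond/= big_pred1_eq/= nth_index.
  - by rewrite -[x in E x](subrK y) (le_trans (ED _ _))// -natr1 mulrDr mulr1 lerD ?FM.
split => //; apply/allpairsP.
have nlt i : (n i < k.+1)%N by rewrite ltnS -nk (bigD1 i)//= leq_addr.
exists (h, [ffun i => Ordinal (nlt i)]); split; rewrite ?mem_enum//=.
by congr (_ + _)%R; apply: eq_bigr => i _; rewrite ffunE.
Qed.

(** Each value is at most c^k times the sum of [f]. There remain the number of points and the size
    of the weight on them, whose product [grow] bounds by a constant times 2^k. *)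
Lemma wsum_iter_econv_finite H F M C c p w v f k :
  (0 < p)%R -> (forall x, (0 <= w x)%R) -> nonneg v -> nonneg f ->
  (forall y, v y != 0 -> y \in F) -> (forall y, f y != 0 -> y \in H) ->
  (forall y, y \in F -> (E y <= M)%R) -> (forall y, y \in H -> (E y <= M)%R) ->
  (forall j x, (E x <= M * j.+1%:R)%R ->
    (j.+1%:R ^+ size F * w x <= C * 2 ^+ j)%R) -> (0 <= C)%R ->
  \esum_(x in [set: X]) v x <= c%:E ->
  wsum p w (iter k (econv v) f) <=
  ((size H)%:R * C)%:E * (\esum_(x in [set: X]) f x) `^ p *
  ((2 * c `^ p) ^+ k)%:E.
Proof.
move=> p0 w0 v0 f0 vF fH FM HM grow C0 vc.
have c0 : (0 <= c)%R by rewrite -lee_fin (le_trans _ vc)// esum_ge0.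
set S := esum _ f; have S0 : 0 <= S by exact: esum_ge0.
have k0 : (0 < k.+1%:R ^+ size F :> R)%R by rewrite exprn_gt0.
(* The largest weight that [grow] allows; its denominator cancels the polynomial factor in the size
   of [combinations]. *)
pose d := (C * 2 ^+ k / k.+1%:R ^+ size F)%R.
have d0 : (0 <= d)%R by rewrite divr_ge0 ?mulr_ge0 ?exprn_ge0// ltW.
have cS0 : 0 <= (c ^+ k)%:E * S by rewrite mule_ge0 ?lee_fin ?exprn_ge0.
apply: (le_trans (wsum_fin_le (L := combinations H F k) p0 w0 _ cS0 d0 _)).
- exact: iter_econv_ge0.
- move=> x xN0; have [xL Ex] := iter_econv_supp vF fH FM HM xN0; split => //.
    apply: (le_trans (esum_ubound x (iter_econv_ge0 k v0 f0))).
    exact: esum_iter_econv.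
  by rewrite ler_pdivlMr// mulrC grow.
rewrite size_combinations poweRM ?lee_fin ?exprn_ge0// poweR_EFin.
have -> : ((c ^+ k) `^ p = (c `^ p) ^+ k)%R.
  by rewrite -!powR_mulrn ?powR_ge0// powRAC.
set s := S `^ p; rewrite (muleC (c `^ p ^+ k)%:E s) -(muleA s) -EFinM muleCA -EFinM.
rewrite (muleC (_ * C)%:E s) -(muleA s) -EFinM.
rewrite le_eqVlt; apply/orP; left; apply/eqP; congr (_ * _%:E).
rewrite natrM natrX /d exprMn; field.
by rewrite gt_eqF.
Qed.

(** Induction on n for all k at once. In one factor v0 + v1, the part [v0] commutes inwards and
    raises k, gaining 1/4, while the part [v1] contributes its [wsum], at most 1/4; the two add up
    to the new factor 1/2. *)
Lemma wsum_iter_econv p w v0 v1 f (K : R) n k :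
  (0 < p <= 1)%R -> (forall x, (0 <= w x)%R) ->
  (forall x y, (w (x + y) <= w x * w y)%R) ->
  nonneg v0 -> nonneg v1 -> nonneg f ->
  wsum p w v1 <= (4^-1)%:E ->
  (forall j, wsum p w (iter j (econv v0) f) <= (K * 4^-1 ^+ j)%:E) ->
  wsum p w (iter n (econv (v0 \+ v1)) (iter k (econv v0) f)) <=
  (K * 4^-1 ^+ k * 2^-1 ^+ n)%:E.
Proof.
move=> pp w0 wM v00 v10 f0 v1e Kj; have p0 : (0 <= p)%R by case/andP: pp => /ltW.
have v0' : nonneg (v0 \+ v1) by move=> x; exact: adde_ge0.
elim: n k => [|n IH] k /=; first by rewrite expr0 mulr1.
rewrite econvDl//; last by do 2!apply: iter_econv_ge0 => //.
apply: (le_trans (wsumD _ _ _ _)) => //.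
- by apply: econv_ge0 => //; do 2!apply: iter_econv_ge0 => //.
- by apply: econv_ge0 => //; do 2!apply: iter_econv_ge0 => //.
rewrite econv_iterC//; last exact: iter_econv_ge0.
have -> : (K * 4^-1 ^+ k * 2^-1 ^+ n.+1)%:E =
    (K * 4^-1 ^+ k.+1 * 2^-1 ^+ n)%:E + (4^-1)%:E * (K * 4^-1 ^+ k * 2^-1 ^+ n)%:E.
  by rewrite -EFinM -EFinD !exprS; congr (_%:E); field.
apply: leeD; first exact: (IH k.+1).
apply: (le_trans (wsum_econv _ _ _ _ _)) => //.
  by do 2!apply: iter_econv_ge0 => //.
by apply: lee_pmul => //; exact: wsum_ge0.
Qed.

End Neumann.

(** * The scalar form of Wiener's lemma *)

Section ScalarWiener.
Context {R : realType} {X : zmodType} (E : X -> R).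
Hypothesis ED : forall x y, E (x + y) <= E x + E y.
Implicit Types (p c C M : R) (f g v : X -> \bar R).

(** The polynomial of degree m pays for counting the support, and M (k + 1) is the distance it can
    reach. The index may depend on both, which covers a single weight as well as a family. *)
Definition subexponential (I : Type) (w : I -> X -> R) :=
  forall (M : R) (m : nat), exists i, exists2 C, 0 <= C &
    forall k x, E x <= M * k.+1%:R -> k.+1%:R ^+ m * w i x <= C * 2 ^+ k.

(* Chosen so that [2 * neumann_radius p `^ p = 1 / 4]: the 2 is the growth rate
   allowed for the weight, and 1/4 + 1/4 < 1 makes the Neumann series converge. *)
Definition neumann_radius p : R := 8^-1 `^ p^-1.

Lemma neumann_radius_gt0 p : 0 < neumann_radius p. Proof. by rewrite powR_gt0. Qed.

Lemma neumann_radius_le p : 0 < p <= 1 -> neumann_radius p <= 8^-1.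
Proof.
by move=> /andP[p0 p1]; apply: ge1r_powR; [lra|rewrite invf_ge1].
Qed.

Lemma neumann_radius_powR p : 0 < p -> 2 * neumann_radius p `^ p = 4^-1.
Proof.
move=> p0; rewrite -powRrM mulVf ?gt_eqF// powRr1 ?invr_ge0//.
by field.
Qed.

Local Open Scope ereal_scope.

(** The part [u0] of [v] on a finite set acts on [f] with iterates decaying like 4^-j, and the rest
    [u1] has [wsum] at most 1/4; hence the iterates of [v] decay like 2^-n and their series
    converges. Finiteness is assumed for the larger weight [w0] and obtained for some [w i]. *)
Lemma scalar_wiener (I : Type) p (w0 : X -> R) (w : I -> X -> R) v f g (H : seq X) :
  (0 < p <= 1)%R ->
  (forall i x, (0 <= w i x)%R) -> (forall i x, (w i x <= w0 x)%R) ->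
  (forall i x y, (w i (x + y) <= w i x * w i y)%R) -> subexponential w ->
  nonneg v -> nonneg f -> nonneg g ->
  (forall x, g x <= f x + econv v g x) ->
  wsum p w0 v < +oo ->
  \esum_(x in [set: X]) v x <= (neumann_radius p)%:E ->
  (forall x, f x != 0 -> x \in H) -> \esum_(x in [set: X]) f x < +oo ->
  \esum_(x in [set: X]) g x < +oo ->
  exists i, wsum p (w i) g < +oo.
Proof.
move=> pp wge0 ww0 wM wsub v0 f0 g0 gfg vfin vs fH ffin gfin.
have /andP[p0 p1] := pp.
have w00 x : (0 <= w0 x)%R.
  by have [i _] := wsub 0%R 0%N; exact: le_trans (wge0 i x) (ww0 i x).
have q0 : (0 < 4^-1 :> R)%R by rewrite invr_gt0.
(* The cut is made in the weight [w0], so the tail is small for every [w i]. The index can then be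
   chosen after [J], from its size and extent, without circularity. *)
have [J _ Jtail] := esum_tail q0
  (fun x => mule_ge0 (poweR_ge0 (v x) p) (w00 x : 0 <= (w0 x)%:E)) vfin.
pose u0 x := if x \in J then v x else 0.
pose u1 x := if x \in J then 0 else v x.
have u00 : nonneg u0 by move=> x; rewrite /u0; case: ifP.
have u10 : nonneg u1 by move=> x; rewrite /u1; case: ifP.
have vE : v = u0 \+ u1.
  by apply/funext => x; rewrite /u0 /u1/=; case: ifP; rewrite ?adde0 ?add0e.
pose M := (\sum_(x <- (J : seq X)) `|E x| + \sum_(x <- H) `|E x|)%R.
have bound (L : seq X) x : x \in L -> (E x <= \sum_(y <- L) `|E y|)%R.
  move=> xL; rewrite (big_rem x)//= (le_trans (ler_norm _))// lerDl.
  by apply: sumr_ge0.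
have JM x : x \in (J : seq X) -> (E x <= M)%R.
  by move=> /bound /le_trans; apply; rewrite lerDl sumr_ge0.
have HM x : x \in H -> (E x <= M)%R.
  by move=> /bound /le_trans; apply; rewrite lerDr sumr_ge0.
have [i [C C0 grow]] := wsub M (size J).
exists i; set S := \esum_(x in [set: X]) f x in ffin.
have S0 : 0 <= S by apply: esum_ge0.
have Sfin : S = (fine S)%:E by rewrite fineK// ge0_fin_numE.
pose K := ((size H)%:R * C * fine S `^ p)%R.
have u0J x : u0 x != 0 -> x \in (J : seq X) by rewrite /u0; case: ifP; rewrite ?eqxx.
have u0s : \esum_(x in [set: X]) u0 x <= (neumann_radius p)%:E.
  apply: le_trans vs; apply: le_esum => x _.
  by rewrite /u0; case: ifP.
have u0K j : wsum p (w i) (iter j (econv u0) f) <= (K * 4^-1 ^+ j)%:E.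
  have := wsum_iter_econv_finite ED j p0 (wge0 i) u00 f0 u0J fH JM HM grow C0 u0s.
  by rewrite -/S Sfin poweR_EFin -!EFinM neumann_radius_powR.
have u1s : wsum p (w i) u1 <= (4^-1)%:E.
  apply: le_trans Jtail; apply: le_esum => x _; rewrite /u1.
  case: ifP => _; first by rewrite poweR0r ?mul0e// gt_eqF.
  by apply: lee_wpmul2l; rewrite ?poweR_ge0 ?lee_fin.
(* The bound K 2^-n, in the shape of the geometric series with sum K * 2. *)
have vK n : wsum p (w i) (iter n (econv v) f) <= (K * 2 / (2 ^ n.+1)%:R)%:E.
  have := wsum_iter_econv n 0 pp (wge0 i) (wM i) u00 u10 f0 u1s u0K.
  rewrite -vE /= expr0 mulr1 => /le_trans; apply.
  rewrite lee_fin expnS natrM natrX exprVn invfM -!mulrA.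
  by rewrite (mulrA 2%R) divff// mul1r.
have g_le x : g x <= \sum_(k <oo) iter k (econv v) f x.
  apply: neumann_le => //; apply: le_trans vs _; rewrite lee_fin.
  by apply: (le_trans (neumann_radius_le pp)); rewrite lef_pV2 ?posrE ?ler_nat.
apply: (@le_lt_trans _ _ (K * 2)%:E); last exact: ltry.
apply: (le_trans (le_wsum (ltW p0) (wge0 i) g0 g_le)).
apply: (le_trans (wsum_series pp (wge0 i) _)) => [k|]; first exact: iter_econv_ge0.
apply: (@le_trans _ _ (\sum_(k <oo) (K * 2 / (2 ^ k.+1)%:R)%:E)).
  apply: lee_nneseries => [k *|k _]; last exact: vK.
  exact: wsum_ge0 (wge0 i).
by apply: epsilon_trick0; rewrite !mulr_ge0 ?powR_ge0.
Qed.

End ScalarWiener.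

(** * Unordered sums and convolution in the algebra *)

#[local] Existing Instance summability.totally_filter.

Section UnorderedSums.
Context {R : realType} {A : banachAlgType R[i]} {I : choiceType}.
Implicit Types (x y : I -> A) (l : A) (J : {fset I}).
Local Open Scope complex_scope.

Lemma normrC_rnorm (a : A) : `|a| = (rnorm a)%:C.
Proof. by rewrite /rnorm RRe_real// normr_real. Qed.

Lemma rnorm_ge0 (a : A) : 0 <= rnorm a.
Proof. by rewrite -lecR -normrC_rnorm normr_ge0. Qed.

Lemma rnorm0 : rnorm (0 : A) = 0.
Proof. by apply: complexI; rewrite -normrC_rnorm normr0. Qed.

Lemma rnormN (a : A) : rnorm (- a) = rnorm a.
Proof. by rewrite /rnorm normrN. Qed.

Lemma rnormD (a b : A) : rnorm (a + b) <= rnorm a + rnorm b.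
Proof.
by rewrite -lecR rmorphD/= -!normrC_rnorm ler_normD.
Qed.

Lemma rnormZ (c : R[i]) (a : A) : rnorm (c *: a) = complex.Re `|c| * rnorm a.
Proof.
apply: complexI; rewrite rmorphM/= RRe_real ?normr_real//.
by rewrite -!normrC_rnorm normrZ.
Qed.

Lemma rnormM (a b : A) : rnorm (bmul a b) <= rnorm a * rnorm b.
Proof. by rewrite -lecR rmorphM/= -!normrC_rnorm bnormM. Qed.

Lemma rnorm_sum (T : Type) (s : seq T) (P : pred T) (x : T -> A) :
  rnorm (\sum_(t <- s | P t) x t) <= \sum_(t <- s | P t) rnorm (x t).
Proof.
elim/big_ind2: _ => [|a r b q ar bq|//]; first by rewrite rnorm0.
exact: le_trans (rnormD _ _) (lerD ar bq).
Qed.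

Lemma big_fset_subset (B : nmodType) (h : I -> B) (J0 J : {fset I}) :
  (J0 `<=` J)%fset -> \sum_(t <- J | t \in J0) h t = \sum_(t <- J0) h t.
Proof.
move=> /fsubsetP J0J; rewrite -big_filter; apply: perm_big; apply: uniq_perm.
- exact/filter_uniq/fset_uniq.
- exact: fset_uniq.
- by move=> t; rewrite mem_filter andb_idr//; exact: J0J.
Qed.

Lemma sum_fset_le_esum (a : I -> R) (J : {fset I}) :
  ((\sum_(t <- J) a t)%:E <= \esum_(t in [set: I]) (a t)%:E)%E.
Proof.
apply: esum_ge; exists [set` J]; first by split => //; exact: finite_fset.
by rewrite fsbig_finite ?finite_fset//= set_fsetK sumEFin.
Qed.

(* [summability.sum] is a total limit operator; this is the convergence that gives
   it a meaning. *)
Definition has_sum x l := forall e : R, 0 < e ->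
  exists J0 : {fset I}, forall J, (J0 `<=` J)%fset ->
    rnorm (l - \sum_(t <- J) x t) < e.

Lemma partial_sumE x J : summability.partial_sum x J = \sum_(t <- J) x t.
Proof. by rewrite /summability.partial_sum big_seq_fsetE. Qed.

Lemma has_sumP x l :
  has_sum x l <-> summability.partial_sum x @ summability.totally --> l.
Proof.
split=> [xl|/cvgrPdist_lt xl e e0].
  apply/cvgrPdist_lt => e e0; have eE : (complex.Re e)%:C = e.
    by rewrite RRe_real// gtr0_real.
  have [|J0 J0P] := xl (complex.Re e); first by rewrite -ltcR eE.
  exists J0 => // J /J0P; rewrite /= partial_sumE.
  by rewrite -ltcR eE -normrC_rnorm.
have [|J0 _ J0P] := xl e%:C; first by rewrite ltcR.
by exists J0 => J /J0P/=; rewrite partial_sumE normrC_rnorm ltcR.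
Qed.

Lemma has_sumE x l : has_sum x l -> summability.sum x = l.
Proof. by move=> /has_sumP; apply: cvg_lim; exact: norm_hausdorff. Qed.

(** By completeness of [A]: once a finite set [J0] carries all but e of the sum of the norms,
    enlarging it changes the partial sum by less than e. *)
Lemma has_sum_abs x :
  (\esum_(t in [set: I]) (rnorm (x t))%:E < +oo)%E ->
  has_sum x (summability.sum x).
Proof.
move=> xfin; apply/has_sumP/cauchy_cvgP/cauchy_exP => e e0.
have eE : (complex.Re e)%:C = e by rewrite RRe_real// gtr0_real.
have e0' : 0 < complex.Re e by rewrite -ltcR eE.
have [J0 J0x _] := esum_tail e0' (fun t => rnorm_ge0 (x t) : 0 <= (rnorm (x t))%:E)%E xfin.
exists (\sum_(t <- J0) x t), J0 => // J J0J.
rewrite /= -ball_normE/= partial_sumE normrC_rnorm -eE ltcR.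
have xJ : \sum_(t <- J) rnorm (x t) < \sum_(t <- J0) rnorm (x t) + complex.Re e.
  rewrite -lte_fin EFinD -!sumEFin; apply: le_lt_trans J0x.
  by rewrite sumEFin; exact: sum_fset_le_esum.
rewrite [X in _ - X](bigID (mem J0))/= big_fset_subset// opprD addrA subrr add0r rnormN.
apply: le_lt_trans (rnorm_sum _ _ _) _; move: xJ.
by rewrite [ltLHS](bigID (mem J0))/= big_fset_subset// ltrD2l.
Qed.

Lemma has_sum_norm_le x l : has_sum x l ->
  ((rnorm l)%:E <= \esum_(t in [set: I]) (rnorm (x t))%:E)%E.
Proof.
move=> xl; apply/lee_addgt0Pr => e e0; have [J /(_ J (fsubset_refl _)) Je] := xl _ e0.
apply: (@le_trans _ _ (\sum_(t <- J) rnorm (x t) + e)%:E); last first.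
  by rewrite EFinD; apply: leeD => //; exact: sum_fset_le_esum.
rewrite lee_fin -[l](subrK (\sum_(t <- J) x t)) (le_trans (rnormD _ _))//.
by rewrite addrC lerD ?rnorm_sum ?ltW.
Qed.

Lemma has_sumD x y l l' : has_sum x l -> has_sum y l' ->
  has_sum (fun t => x t + y t) (l + l').
Proof.
move=> xl yl e e0; have e2 : 0 < e / 2 by rewrite divr_gt0.
have [J1 J1P] := xl _ e2; have [J2 J2P] := yl _ e2.
exists (J1 `|` J2)%fset => J; rewrite fsubUset => /andP[/J1P xe /J2P ye].
rewrite big_split/= opprD addrACA (le_lt_trans (rnormD _ _))//.
by rewrite [ltRHS]splitr ltrD.
Qed.

Lemma has_sumN x l : has_sum x l -> has_sum (fun t => - x t) (- l).
Proof.
move=> xl e e0; have [J0 J0P] := xl _ e0; exists J0 => J /J0P.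
by rewrite sumrN -opprD rnormN.
Qed.

Lemma has_sumB x y l l' : has_sum x l -> has_sum y l' ->
  has_sum (fun t => x t - y t) (l - l').
Proof. by move=> xl yl; apply: has_sumD => //; exact: has_sumN. Qed.

Lemma has_sum_fset x J : (forall t, t \notin J -> x t = 0) ->
  has_sum x (\sum_(t <- J) x t).
Proof.
move=> x0 e e0; exists J => J' JJ'.
rewrite -(big_fset_subset _ JJ') [X in _ - X](bigID (mem J))/=.
by rewrite [X in _ - (_ + X)]big1 ?addr0 ?subrr ?rnorm0// => t /x0.
Qed.

Lemma has_sum_sum (T : Type) (s : seq T) (y : T -> I -> A) (l : T -> A) :
  (forall j, has_sum (y j) (l j)) ->
  has_sum (fun t => \sum_(j <- s) y j t) (\sum_(j <- s) l j).
Proof.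
move=> yl; elim: s => [|j s IH]; last first.
  rewrite big_cons [X in has_sum X](_ : _ = fun t => y j t + \sum_(k <- s) y k t).
    exact: has_sumD.
  by apply/funext => t; rewrite big_cons.
move=> e e0; exists fset0 => J _.
by rewrite big_nil big1 ?subrr ?rnorm0// => t _; rewrite big_nil.
Qed.

Lemma bmul0l (a : A) : bmul 0 a = 0.
Proof. by apply: (addrI (bmul 0 a)); rewrite -bmulDl !addr0. Qed.

Lemma bmul0r (a : A) : bmul a 0 = 0.
Proof. by apply: (addrI (bmul a 0)); rewrite -bmulDr !addr0. Qed.

Lemma bmulNl (a b : A) : bmul (- a) b = - bmul a b.
Proof. by apply: (addrI (bmul a b)); rewrite -bmulDl !subrr bmul0l. Qed.

Lemma bmulNr (a b : A) : bmul a (- b) = - bmul a b.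
Proof. by apply: (addrI (bmul a b)); rewrite -bmulDr !subrr bmul0r. Qed.

Lemma bmul_suml (T : Type) (s : seq T) (z : T -> A) (b : A) :
  bmul (\sum_(t <- s) z t) b = \sum_(t <- s) bmul (z t) b.
Proof. by elim/big_ind2: _ => [|u u' w w' <- <-|//]; rewrite ?bmul0l ?bmulDl. Qed.

Lemma bmul_sumr (T : Type) (s : seq T) (z : T -> A) (b : A) :
  bmul b (\sum_(t <- s) z t) = \sum_(t <- s) bmul b (z t).
Proof. by elim/big_ind2: _ => [|u u' w w' <- <-|//]; rewrite ?bmul0r ?bmulDr. Qed.

Lemma has_sum_mulr x l (b : A) : has_sum x l ->
  has_sum (fun t => bmul (x t) b) (bmul l b).
Proof.
(* Adding 1 keeps the divisor positive when [b] is zero. *)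
move=> xl e e0; have b0 : 0 < rnorm b + 1 by rewrite ltr_wpDl ?rnorm_ge0.
have [J0 J0P] := xl _ (divr_gt0 e0 b0); exists J0 => J /J0P; rewrite ltr_pdivlMr// => Je.
rewrite -bmul_suml -bmulNl -bmulDl (le_lt_trans (rnormM _ _))// (le_lt_trans _ Je)//.
by rewrite ler_wpM2l ?rnorm_ge0// lerDl.
Qed.

Lemma has_sum_bij x l (h h' : I -> I) : cancel h h' -> cancel h' h ->
  has_sum x l -> has_sum (fun t => x (h t)) l.
Proof.
move=> hK h'K xl e e0; have [J0 J0P] := xl _ e0.
exists [fset h' t | t in J0]%fset => J /fsubsetP J0J.
have -> : \sum_(t <- J) x (h t) = \sum_(t <- [fset h t | t in J]%fset) x t.
  by rewrite big_imfset//= => s t _ _ /(can_inj hK).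
apply: J0P; apply/fsubsetP => t tJ0; apply/imfsetP; exists (h' t) => /=.
  by apply: J0J; apply/imfsetP; exists t.
by rewrite h'K.
Qed.

End UnorderedSums.

(** * Convolution of functions with values in the algebra *)

Section AlgebraConvolution.
Context {R : realType} {D : lattice_rank} {A : banachAlgType R[i]}.
Local Notation X := (lattice D).
Implicit Types (f g h : X -> A) (p : R) (w : X -> R).
Local Open Scope ereal_scope.

Definition absf f : X -> \bar R := fun x => (rnorm (f x))%:E.

Lemma absf_ge0 f : nonneg (absf f).
Proof. by move=> x; rewrite lee_fin rnorm_ge0. Qed.
#[local] Hint Resolve absf_ge0 : core.

Lemma mule_lty (a b : \bar R) : 0 <= a -> a < +oo -> b < +oo -> a * b < +oo.
Proof. by move=> a0 afin bfin; rewrite lte_mul_pinfty// ge0_fin_numE. Qed.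

Lemma esum_absf_ge0 f : 0 <= \esum_(x in [set: X]) absf f x.
Proof. by apply: esum_ge0 => x _; exact: absf_ge0. Qed.
#[local] Hint Resolve esum_absf_ge0 : core.

Definition l1 f : Prop := \esum_(x in [set: X]) absf f x < +oo.

Lemma econv_fin f g x : l1 f -> l1 g -> econv (absf g) (absf f) x < +oo.
Proof.
move=> f1 g1; apply: le_lt_trans (esum_ubound x _) _; first exact: econv_ge0.
apply: le_lt_trans (esum_econv _ _) _ => //.
exact: mule_lty.
Qed.

Lemma esum_bmul_le f g x :
  \esum_(y in [set: X]) (rnorm (bmul (f (x - y)%R) (g y)))%:E <=
  econv (absf g) (absf f) x.
Proof. by apply: le_esum => y _; rewrite -EFinM lee_fin rnormM. Qed.

Lemma conv_has_sum f g x : l1 f -> l1 g ->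
  has_sum (fun y => bmul (f (x - y)%R) (g y)) (conv f g x).
Proof.
by move=> f1 g1; apply/has_sum_abs/(le_lt_trans (esum_bmul_le _ _ _))/econv_fin.
Qed.

Lemma absf_conv_le f g x : l1 f -> l1 g ->
  absf (conv f g) x <= econv (absf g) (absf f) x.
Proof.
move=> f1 g1; apply: le_trans (esum_bmul_le _ _ _).
exact/has_sum_norm_le/conv_has_sum.
Qed.

Lemma wsum_finite_support p w f (J : {fset X}) : (0 < p)%R ->
  (forall x, (0 <= w x)%R) -> (forall x, x \notin J -> f x = 0%R) ->
  wsum p w (absf f) < +oo.
Proof.
move=> p0 w0 fJ.
have -> : wsum p w (absf f) =
    \esum_(x in [set` J]) (absf f x `^ p * (w x)%:E).
  rewrite [RHS]esum_mkcond; apply: eq_esum => x _.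
  rewrite mem_setE; case: ifPn => // /fJ.
  by rewrite /absf => ->; rewrite rnorm0 poweR0r ?mul0e// gt_eqF.
rewrite esum_fset ?finite_fset//; last first.
  by move=> x _; rewrite mule_ge0 ?poweR_ge0 ?lee_fin.
rewrite fsbig_finite ?finite_fset//=; apply: lte_sum_pinfty => x _.
by rewrite -EFinM ltry.
Qed.

Definition restr (J : {fset X}) f : X -> A := fun x => if x \in J then f x else 0%R.
Definition corestr (J : {fset X}) f : X -> A := fun x => if x \in J then 0%R else f x.

Section Inverse.
Variables f g : X -> A.
Hypotheses (f1 : l1 f) (g1 : l1 g).
Hypotheses (fg : conv f g = delta0) (gf : conv g f = delta0).
Variable J : {fset X}.

Definition defect : X -> A :=
  fun z => (delta0 z - \sum_(y <- J) bmul (f (z - y)) (g y))%R.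

Lemma sum_restr (a : X -> A) (b : X -> A) :
  (\sum_(y <- J) bmul (a y) (restr J b y) = \sum_(y <- J) bmul (a y) (b y))%R.
Proof. by apply: eq_big_seq => y yJ; rewrite /restr yJ. Qed.

Lemma has_sum_restr z :
  has_sum (fun y => bmul (f (z - y)%R) (restr J g y))
    (\sum_(y <- J) bmul (f (z - y)) (g y))%R.
Proof.
rewrite -sum_restr; apply: has_sum_fset => y yJ.
by rewrite /restr (negPf yJ) bmul0r.
Qed.

(** Subtracting f * restr J g from f * g = [delta0] leaves f * corestr J g, the convolution of [f]
    with the tail of [g]. *)
Lemma defect_has_sum z :
  has_sum (fun y => bmul (f (z - y)%R) (corestr J g y)) (defect z).
Proof.
have := has_sumB (conv_has_sum z f1 g1) (has_sum_restr z).
rewrite fg -/(defect z); congr has_sum; apply/funext => y.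
rewrite /restr /corestr; case: ifP => _; first by rewrite subrr bmul0r.
by rewrite bmul0r subr0.
Qed.

Lemma absf_defect_le z : absf defect z <= econv (absf (corestr J g)) (absf f) z.
Proof. exact: le_trans (has_sum_norm_le (defect_has_sum z)) (esum_bmul_le _ _ _). Qed.

(** The two bounds on the defect have different uses. [absf_defect_le] makes its ell^1 norm small
    along with the tail of [g]. This one involves [g] only through a finitely supported function, so
    it gives finiteness in weighted quasi-norms, where nothing is yet known about [g]. *)
Lemma absf_defect_le' z : absf defect z <=
  (absf delta0 \+ econv (absf (restr J g)) (absf f)) z.
Proof.
apply: (@le_trans _ _ (absf delta0 z +
    (rnorm (\sum_(y <- J) bmul (f (z - y)) (g y))%R)%:E)).
  rewrite -EFinD lee_fin (le_trans (rnormD _ _))//.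
  by rewrite rnormN.
apply: leeD => //.
exact: le_trans (has_sum_norm_le (has_sum_restr z)) (esum_bmul_le _ _ _).
Qed.

Lemma corestr_l1 : l1 (corestr J g).
Proof.
apply: le_lt_trans g1; apply: le_esum => x _; rewrite lee_fin /corestr.
by case: ifP => // _; rewrite rnorm0 rnorm_ge0.
Qed.

Lemma defect_l1 : l1 defect.
Proof.
apply: le_lt_trans (le_esum (fun x _ => absf_defect_le x)) _.
apply: le_lt_trans (esum_econv _ _) _ => //.
by apply: mule_lty => //; exact: corestr_l1.
Qed.

(* [g - g * (f * restr J g) = g - restr J g], where the sum over [J] is finite, so
   only reindexing and right multiplication of sums are involved. *)
Lemma conv_defect x : conv g defect x = (g x - restr J g x)%R.
Proof.
have delta_sum : has_sum (fun z => bmul (g (x - z)%R) (delta0 z)) (g x).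
  rewrite [X in has_sum _ X](_ : _ =
    \sum_(z <- [fset (0%R : X)]%fset) bmul (g (x - z)) (delta0 z))%R.
    apply: has_sum_fset => z; rewrite inE => z0.
    by rewrite /Defs.delta0 (negPf z0) bmul0r.
  by rewrite big_seq_fset1 /Defs.delta0 eqxx subr0 bmul1r.
have term_sum y : has_sum (fun z => bmul (bmul (g (x - z)%R) (f (z - y)%R)) (g y))
    (bmul (delta0 (x - y)%R) (g y)).
  apply: has_sum_mulr; rewrite -gf.
  have := has_sum_bij (addrNK y : cancel (fun z => z - y)%R (fun z => z + y)%R)
    (addrK y) (conv_has_sum (x - y)%R g1 f1).
  congr has_sum; apply/funext => z; congr (bmul (g _) _).
  by rewrite opprB addrA subrK.
have := has_sumB delta_sum (has_sum_sum J term_sum).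
rewrite [X in has_sum X](_ : _ = fun z => bmul (g (x - z)%R) (defect z)); last first.
  apply/funext => z; rewrite /defect bmulDr bmulNr bmul_sumr; congr (_ - _)%R.
  by apply: eq_bigr => y _; rewrite bmulA.
move=> /has_sumE; rewrite /Defs.conv => ->; congr (_ - _)%R; rewrite /restr; case: ifPn => xJ.
  rewrite (big_fsetD1 x)//= subrr /Defs.delta0 eqxx bmul1l big_seq big1 ?addr0// => y.
  by rewrite !inE => /andP[yx _]; rewrite subr_eq0 eq_sym (negPf yx) bmul0l.
rewrite big_seq big1// => y yJ; rewrite /Defs.delta0 subr_eq0.
by case: eqP => [xy|_]; rewrite ?bmul0l//; move: xJ; rewrite xy yJ.
Qed.

Lemma absf_inverse_le x :
  absf g x <= absf (restr J g) x + econv (absf defect) (absf g) x.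
Proof.
apply: le_trans (leeD (lexx _) (absf_conv_le x g1 defect_l1)).
by rewrite -EFinD lee_fin conv_defect (le_trans _ (rnormD _ _))// addrC subrK.
Qed.

End Inverse.

Lemma wiener (E : X -> R) (I : Type) p (w0 : X -> R) (w : I -> X -> R) f g :
  (forall x y, (E (x + y) <= E x + E y)%R) -> (0 < p <= 1)%R ->
  (forall x, (0 <= w0 x)%R) -> (forall x y, (w0 (x + y) <= w0 x * w0 y)%R) ->
  (forall i x, (0 <= w i x)%R) -> (forall i x, (w i x <= w0 x)%R) ->
  (forall i x y, (w i (x + y) <= w i x * w i y)%R) -> subexponential E w ->
  l1 f -> wsum p w0 (absf f) < +oo -> l1 g ->
  conv f g = delta0 -> conv g f = delta0 ->
  exists i, wsum p (w i) (absf g) < +oo.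
Proof.
move=> ED pp w00 w0M wi0 wiw0 wiM wsub f1 fp g1 fg gf.
have /andP[p0 p1] := pp.
set S := \esum_(x in [set: X]) absf f x in f1.
have S0 : 0 <= S by exact: esum_absf_ge0.
have Sfin : S = (fine S)%:E by rewrite fineK// ge0_fin_numE.
have S1 : (0 < fine S + 1)%R by rewrite ltr_wpDl ?fine_ge0.
(* The tail of [g] times the ell^1 norm of [f] has to stay below the radius; the added 1 avoids a
   division by zero when [f] vanishes. *)
have [J _ Jtail] := esum_tail (divr_gt0 (neumann_radius_gt0 p) S1) (absf_ge0 g) g1.
have restr_fin q (u : X -> R) : (0 < q)%R -> (forall x, (0 <= u x)%R) ->
    wsum q u (absf (restr J g)) < +oo.
  move=> q0 u0; apply: (wsum_finite_support (J := J)) => // x xJ.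
  by rewrite /restr (negPf xJ).
apply: (scalar_wiener ED (w0 := w0) pp wi0 wiw0 wiM wsub
    (v := absf (defect f g J)) (f := absf (restr J g)) (H := J)) => //.
- exact: absf_inverse_le.
- apply: (le_lt_trans (le_wsum (ltW p0) w00 (absf_ge0 _) (absf_defect_le' f g J))).
  apply: (le_lt_trans (wsumD pp w00 (absf_ge0 _) _)); first exact: econv_ge0.
  apply: lte_add_pinfty.
    apply: (wsum_finite_support (J := [fset (0%R : X)]%fset)) => // x.
    by rewrite inE /Defs.delta0 => /negPf ->.
  apply: (le_lt_trans (wsum_econv pp w00 w0M _ _)) => //.
  by apply: mule_lty => //; [exact: wsum_ge0|exact: restr_fin].
- apply: (le_trans (le_esum (fun x _ => absf_defect_le f1 g1 fg J x))).
  apply: (le_trans (esum_econv _ _)) => //; rewrite -/S Sfin.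
  apply: (@le_trans _ _ ((neumann_radius p / (fine S + 1))%:E * (fine S)%:E)).
    apply: lee_pmul => //; rewrite ?esum_absf_ge0 ?lee_fin ?fine_ge0//.
    apply: le_trans Jtail; apply: le_esum => x _; rewrite /absf /corestr.
    by case: ifP; rewrite ?rnorm0.
  rewrite -EFinM lee_fin mulrAC -mulrA ger_pMr ?neumann_radius_gt0//.
  by rewrite ler_pdivrMr// mul1r lerDl.
- move=> x; apply: contraNT => xJ; apply/eqP.
  by rewrite /absf /restr (negPf xJ) rnorm0.
- rewrite -(wsum1 (absf_ge0 _)); exact: restr_fin.
Qed.

End AlgebraConvolution.

(** * Weights *)

Section EuclideanNorm.
Context {R : realType}.

(** Adds one coordinate: s, p, q stand for the sums of squares over the coordinates already treated.
    After squaring, the claim reduces to Cauchy-Schwarz in the plane. *)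
Lemma minkowski_step (s p q a b : R) : 0 <= s -> 0 <= p -> 0 <= q ->
  Num.sqrt s <= Num.sqrt p + Num.sqrt q ->
  Num.sqrt (s + (a + b) ^+ 2) <= Num.sqrt (p + a ^+ 2) + Num.sqrt (q + b ^+ 2).
Proof.
move=> s0 p0 q0 spq.
have sq x : 0 <= x -> Num.sqrt x * Num.sqrt x = x :> R.
  by move=> x0; rewrite -expr2 sqr_sqrtr.
have pa : 0 <= p + a ^+ 2 by rewrite addr_ge0 ?sqr_ge0.
have qb : 0 <= q + b ^+ 2 by rewrite addr_ge0 ?sqr_ge0.
have hs := sq _ s0; have hp := sq _ p0; have hq := sq _ q0.
have s0' := sqrtr_ge0 s; have p0' := sqrtr_ge0 p; have q0' := sqrtr_ge0 q.
have pa0 := sqrtr_ge0 (p + a ^+ 2); have qb0 := sqrtr_ge0 (q + b ^+ 2).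
set S := Num.sqrt s in spq hs s0'; set P := Num.sqrt p in spq hp p0'.
set Q := Num.sqrt q in spq hq q0'.
have hpa := sq _ pa; have hqb := sq _ qb.
set U := Num.sqrt (p + _) in pa0 hpa *; set V := Num.sqrt (q + _) in qb0 hqb *.
rewrite -[leRHS]ger0_norm ?addr_ge0// -sqrtr_sqr ler_sqrt ?sqr_ge0//.
(* Cauchy-Schwarz from (P b - Q a)^2 >= 0; the case of a nonpositive left side is set apart so that
   squaring is legitimate. *)
have UV : P * Q + a * b <= U * V.
  have UV0 : 0 <= U * V by rewrite mulr_ge0.
  have [/le_trans->//|/ltW PQ0] := leP (P * Q + a * b) 0.
  rewrite -(ler_pXn2r (n := 2))// ?nnegrE// exprMn (expr2 U) (expr2 V) hpa hqb.
  rewrite -hp -hq; have : 0 <= (P * b - Q * a) ^+ 2 by exact: sqr_ge0.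
  nra.
have : S * S <= (P + Q) * (P + Q) by rewrite ler_pM.
rewrite -hs !expr2 => SPQ; nra.
Qed.

Lemma minkowski_seq (T : Type) (r : seq T) (a b : T -> R) :
  Num.sqrt (\sum_(i <- r) (a i + b i) ^+ 2) <=
  Num.sqrt (\sum_(i <- r) a i ^+ 2) + Num.sqrt (\sum_(i <- r) b i ^+ 2).
Proof.
elim: r => [|i r IH]; first by rewrite !big_nil sqrtr0 addr0.
rewrite !big_cons ![_ ^+ 2 + \sum_(j <- r) _]addrC.
by apply: minkowski_step => //; apply: sumr_ge0 => j _; exact: sqr_ge0.
Qed.

Lemma euclid_ge0 (D : lattice_rank) (x : lattice D) : 0 <= euclid R x.
Proof. by case: D x => [d|] x; exact: sqrtr_ge0. Qed.

(** The supports of x, y and x + y differ; their norms become comparable over one common finite set,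
    the added coefficients being zero. *)
Lemma euclid_malgE (x : monalg.malg nat int) (J : {fset nat}) :
  (monalg.msupp x `<=` J)%fset ->
  euclid R (x : lattice CountableRank) =
  Num.sqrt (\sum_(i <- J) (monalg.mcoeff i x)%:~R ^+ 2).
Proof.
move=> xJ; rewrite /euclid -(big_fset_subset _ xJ) big_mkcond/=.
congr Num.sqrt; apply: eq_bigr => i _; case: ifPn => // /monalg.mcoeff_outdom ->.
by rewrite expr0n.
Qed.

Lemma euclidD (D : lattice_rank) (x y : lattice D) :
  euclid R (x + y) <= euclid R x + euclid R y.
Proof.
case: D x y => [d|] x y.
  have := minkowski_seq (index_enum 'I_d)
    (fun i => (x ord0 i)%:~R) (fun i => (y ord0 i)%:~R).
  apply: le_trans; rewrite /euclid; under eq_bigr do rewrite mxE rmorphD.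
  exact: lexx.
pose J := (monalg.msupp x `|` monalg.msupp y)%fset.
rewrite (euclid_malgE (J := J)); last exact: monalg.msuppD_le.
rewrite (euclid_malgE (fsubsetUl _ (monalg.msupp y))).
rewrite (euclid_malgE (fsubsetUr (monalg.msupp x) _)) -/J.
under eq_bigr do rewrite monalg.mcoeffD rmorphD.
exact: minkowski_seq.
Qed.

End EuclideanNorm.

(** * Comparison of polynomial, power and exponential growth *)

Section Weights.
Context {R : realType}.
Implicit Types (a b r s t d p : R).

Lemma poly_le_exp s d : 0 <= s -> 0 < d ->
  exists2 C, 0 <= C & forall t, 0 <= t -> (1 + t) `^ s <= C * expR (d * t).
Proof.
move=> s0 d0; have s1 : 0 < s + 1 by rewrite ltr_wpDl.
(* Raising 1 + t <= (1 + 1/e) exp(e t) to the power s produces the rate e s, which this choice keeps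
   below d; s + 1 in place of s allows s = 0. *)
pose e := d / (s + 1); have e0 : 0 < e by rewrite divr_gt0.
exists ((1 + e^-1) `^ s) => [|t t0]; first exact: powR_ge0.
have e1 : 0 <= 1 + e^-1 by apply: addr_ge0 => //; rewrite invr_ge0 ltW.
have le1 : 1 + t <= (1 + e^-1) * expR (e * t).
  apply: (@le_trans _ _ ((1 + e^-1) * (1 + e * t))).
    have -> : (1 + e^-1) * (1 + e * t) = 1 + t + (e^-1 + e * t).
      by field; rewrite gt_eqF.
    by rewrite lerDl; apply: addr_ge0; [rewrite invr_ge0|apply: mulr_ge0 => //]; exact: ltW.
  by apply: ler_wpM2l; [exact: e1|exact: expR_ge1Dx].
apply: (@le_trans _ _ (((1 + e^-1) * expR (e * t)) `^ s)).
  by rewrite ge0_ler_powR// ?nnegrE ?addr_ge0 ?mulr_ge0 ?expR_ge0.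
rewrite powRM ?expR_ge0// -expRM ler_wpM2l ?powR_ge0// ler_expR.
by rewrite mulrAC ler_wpM2r// /e mulrAC ler_pdivrMr// ler_wpM2l ?(ltW d0)// lerDl.
Qed.

Lemma powR_le_linear a b d : 0 < a -> 0 < b < 1 -> 0 < d ->
  exists2 C, 0 <= C & forall t, 0 <= t -> a * t `^ b <= d * t + C.
Proof.
move=> a0 /andP[b0 b1] d0.
(* The crossing point, where a T^b = d T: up to [T] the constant dominates, beyond it the linear
   term. *)
pose T := (d / a) `^ (b - 1)^-1; have T0 : 0 < T by rewrite powR_gt0// divr_gt0.
exists (a * T `^ b) => [|t t0]; first by rewrite mulr_ge0 ?powR_ge0 ?ltW.
have [tT|/ltW Tt] := leP t T.
  rewrite (@le_trans _ _ (a * T `^ b))//; last by rewrite lerDr mulr_ge0// ltW.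
  by rewrite ler_pM2l//; apply: ge0_ler_powR; rewrite ?nnegrE// ltW.
have t_gt0 : 0 < t by exact: lt_le_trans Tt.
apply: (@le_trans _ _ (d * t)); last by rewrite lerDl mulr_ge0 ?powR_ge0// ltW.
rewrite -mulr_powRB1// mulrCA [leRHS]mulrC ler_pM2l// mulrC -ler_pdivlMr//.
have -> : d / a = T `^ (b - 1).
  by rewrite -powRrM mulVf ?powRr1 ?divr_ge0 ?(ltW a0) ?(ltW d0)// subr_eq0 lt_eqF.
have -> : b - 1 = - (1 - b) by rewrite opprB.
rewrite !powRN lef_pV2 ?posrE ?powR_gt0 ?divr_gt0//.
by apply: ge0_ler_powR; rewrite ?nnegrE ?subr_ge0// ltW.
Qed.

(** A power of exp(1/2) <= 2, which is the inverse of exp(-1/2) >= 1 - 1/2. *)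
Lemma expR_half_le (k : nat) : expR (2^-1 * k.+1%:R) <= 2 * 2 ^+ k :> R.
Proof.
rewrite expRM_natr -exprS lerXn2r ?nnegrE ?expR_ge0//.
have := expR_ge1Dx (- 2^-1 : R); rewrite expRN => h.
rewrite -[leLHS]invrK -[leRHS]invrK lef_pV2 ?posrE ?invr_gt0 ?expR_gt0//.
by apply: le_trans h; lra.
Qed.

(** Growth 2^k leaves room for the exponential rate 1/2, shared equally: 1/4 for the polynomial
    factor and 1/4 for the weight. *)
Lemma subexponential_of_exp_bound (X : zmodType) (E : X -> R) (I : Type)
    (w : I -> X -> R) : (forall x, 0 <= E x) ->
  (forall d, 0 < d -> exists i, exists2 K, 0 <= K &
    forall x, w i x <= K * expR (d * E x)) ->
  subexponential E w.
Proof.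
move=> E0 wexp M m; pose M' := `|M| + 1.
have M'0 : 0 < M' by rewrite ltr_wpDl.
(* Where E x <= M (k + 1), this rate yields an exponent of at most (k + 1) / 4; [M'] is positive
   whatever the sign of [M]. *)
have [|i [K K0 wK]] := wexp (4^-1 / M'); first by rewrite divr_gt0.
have [|C C0 mC] := @poly_le_exp m%:R 4^-1 (ler0n _ _); first by [].
exists i; exists (2 * (C * K)) => [|k x Ex]; first by rewrite !mulr_ge0.
have k0 : 0 <= k.+1%:R :> R by [].
have wk : w i x <= K * expR (4^-1 * k.+1%:R).
  apply: (le_trans (wK x)); rewrite ler_wpM2l// ler_expR -mulrA ler_wpM2l//.
  rewrite ler_pdivrMl// (le_trans Ex)// ler_wpM2r//.
  by rewrite (le_trans (ler_norm M))// lerDl.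
have mk : k.+1%:R ^+ m <= C * expR (4^-1 * k.+1%:R).
  have /(le_trans _) := mC _ k0; apply.
  by rewrite powR_mulrn ?addr_ge0// lerXn2r ?nnegrE ?addr_ge0// lerDr.
apply: (@le_trans _ _ ((C * expR (4^-1 * k.+1%:R)) * (K * expR (4^-1 * k.+1%:R)))).
  apply: (le_trans (ler_wpM2l (exprn_ge0 m k0) wk)).
  by rewrite ler_wpM2r// mulr_ge0 ?expR_ge0.
rewrite mulrACA -expRD -mulrDl (_ : 4^-1 + 4^-1 = 2^-1); last by field.
rewrite (mulrC 2 (C * K)) -[leRHS]mulrA ler_wpM2l ?mulr_ge0//.
exact: expR_half_le.
Qed.

End Weights.

(** * Weighted convolution algebras *)

Section WeightedSpaces.
Context {R : realType} {D : lattice_rank} {A : banachAlgType R[i]}.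
Local Notation X := (lattice D).
Local Notation E := (@euclid R D).
Implicit Types (f g : X -> A) (p q s d K : R) (w : X -> R).

Definition is_weight w :=
  (forall x, 1 <= w x) /\ (forall x y, w (x + y) <= w x * w y).

(* The Gelfand-Raikov-Shilov condition. For families it is uniform only in that
   the index may depend on the rate [d]. *)
Definition GRS (I : Type) (w : I -> X -> R) := forall d, 0 < d ->
  exists i, exists2 K, 0 <= K & forall x, w i x <= K * expR (d * E x).

Lemma omega_weightP s : 0 <= s -> is_weight (omega_weight s).
Proof.
move=> s0; have E1 (x : X) : 1 <= 1 + E x by rewrite lerDl euclid_ge0.
have E0 (x : X) : 0 <= 1 + E x by exact: le_trans (E1 x).
split=> [x|x y]; rewrite /omega_weight.
  by rewrite -[leLHS](powRr0 (1 + E x)) ler_powR.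
rewrite -powRM//; apply: ge0_ler_powR; rewrite ?nnegrE// ?mulr_ge0//.
rewrite mulrDl mul1r mulrDr mulr1 addrACA -!addrA lerD2l.
have := euclidD (R := R) x y; have := mulr_ge0 (euclid_ge0 (R := R) x) (euclid_ge0 (R := R) y).
lra.
Qed.

Lemma nu_weightP s : 0 <= s -> is_weight (nu_weight s).
Proof.
move=> s0; have s1 : 0 < s + 1 by rewrite ltr_wpDl.
split=> [x|x y]; rewrite /nu_weight.
  by rewrite -[leLHS]expR0 ler_expR divr_ge0 ?euclid_ge0 ?ltW.
by rewrite -expRD ler_expR -mulrDl ler_wpM2r ?euclidD// invr_ge0 ltW.
Qed.

Lemma eta_weightP a b : 0 < a -> 0 < b < 1 -> is_weight (eta_weight a b).
Proof.
move=> a0 /andP[b0 b1]; split=> [x|x y]; rewrite /eta_weight.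
  by rewrite -[leLHS]expR0 ler_expR mulr_ge0 ?powR_ge0 ?ltW.
rewrite -expRD ler_expR -mulrDr ler_pM2l//.
apply: (@le_trans _ _ ((E x + E y) `^ b)).
  by apply: ge0_ler_powR; rewrite ?nnegrE ?addr_ge0 ?euclid_ge0 ?euclidD// ltW.
by apply: powRD_le; rewrite ?euclid_ge0// b0 ltW.
Qed.

Lemma omega_GRS s : 0 <= s -> GRS (fun _ : unit => omega_weight s).
Proof.
move=> s0 d d0; exists tt; have [C C0 CP] := poly_le_exp s0 d0.
by exists C => // x; apply: CP; exact: euclid_ge0.
Qed.

Lemma eta_GRS a b : 0 < a -> 0 < b < 1 -> GRS (fun _ : unit => eta_weight a b).
Proof.
move=> a0 b01 d d0; exists tt; have [C C0 CP] := powR_le_linear a0 b01 d0.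
exists (expR C) => [|x]; first exact: expR_ge0.
by rewrite -expRD ler_expR addrC CP ?euclid_ge0.
Qed.

(** The rate 1 / (m + i + 1) falls below d once i >= 1 / d. Starting at m keeps all these weights
    below the one of index m. *)
Lemma nu_GRS (m : nat) : GRS (fun i => nu_weight (m + i)%:R).
Proof.
move=> d d0; exists (Num.bound d^-1); exists 1 => // x.
rewrite mul1r ler_expR mulrC ler_wpM2r ?euclid_ge0// -[leRHS]invrK.
rewrite lef_pV2 ?posrE ?invr_gt0 ?ltr_wpDl//.
have := archi_boundP (ltW (_ : 0 < d^-1)); rewrite invr_gt0 => /(_ d0) /ltW /le_trans.
by apply; rewrite natr1 ler_nat leqW// leq_addl.
Qed.

Lemma nu_weight_antimono (m n : nat) (x : X) : (m <= n)%N ->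
  nu_weight n%:R x <= nu_weight m%:R x :> R.
Proof.
move=> mn; rewrite ler_expR ler_wpM2l ?euclid_ge0// lef_pV2 ?posrE ?ltr_wpDl//.
by rewrite lerD2r ler_nat.
Qed.

Lemma ellE p w f :
  ell D A p w f = (wsum p (fun x => (w x `^ p)%R) (absf f) < +oo)%E.
Proof. by []. Qed.

Lemma ell1E f : ell1 D A f <-> l1 f.
Proof.
by rewrite /l1 -(wsum1 (absf_ge0 f)) /ell1 ellE powR1.
Qed.

(** Subadditivity with the exponent p / q <= 1 compares the two sums; the constant between the
    weights comes out as the factor K^p. *)
Lemma sub_ell p q w w' K : 0 < p -> p <= q -> 0 <= K ->
  (forall x, 0 <= w x) -> (forall x, 0 <= w' x) ->
  (forall x, w' x <= K * w x) -> ell D A p w `<=` ell D A q w'.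
Proof.
move=> p0 pq K0 w0 w'0 ww' f; have q0 : 0 < q by exact: lt_le_trans pq.
have r01 : 0 < p / q <= 1 by rewrite divr_gt0//= ler_pdivrMr// mul1r.
have rN0 : p / q != 0 by case/andP: r01 => r0 _; rewrite gt_eqF.
rewrite /ell/= => fin; apply: (lty_poweRy rN0).
apply: le_lt_trans (poweR_esum_le r01 _) _ => [x|].
  by rewrite lee_fin mulr_ge0 ?powR_ge0.
apply: (@le_lt_trans _ _ (\esum_(x in [set: X])
    ((K `^ p)%:E * (rnorm (f x) `^ p * w x `^ p)%:E))%E).
  apply: le_esum => x _; rewrite poweR_EFin -EFinM lee_fin.
  rewrite -powRM ?rnorm_ge0// -powRrM mulrCA divff ?gt_eqF// mulr1.
  rewrite powRM ?rnorm_ge0// mulrCA ler_wpM2l ?powR_ge0// -powRM//.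
  by apply: ge0_ler_powR; rewrite ?nnegrE ?mulr_ge0// ltW.
rewrite ge0_esumZl ?lee_fin ?powR_ge0//; last first.
  by move=> x; rewrite lee_fin mulr_ge0 ?powR_ge0.
by apply: mule_lty => //; rewrite ?lee_fin ?powR_ge0 ?ltry.
Qed.

Lemma powR_weight p w : 0 < p <= 1 -> is_weight w ->
  [/\ forall x, 0 <= w x `^ p, forall x, w x `^ p <= w x &
      forall x y, w (x + y) `^ p <= w x `^ p * w y `^ p].
Proof.
move=> /andP[p0 p1] [w1 wM]; split=> [x|x|x y]; first exact: powR_ge0.
  exact: ler1_powR.
have w0 x' : 0 <= w x' by exact: le_trans (w1 x').
rewrite -powRM//; apply: ge0_ler_powR; rewrite ?nnegrE ?mulr_ge0//.
exact: ltW.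
Qed.

Lemma ell_sub_ell1 p w : 0 < p <= 1 -> is_weight w -> ell D A p w `<=` ell1 D A.
Proof.
move=> /andP[p0 p1] [w1 _]; have w0 x : 0 <= w x by exact: le_trans (w1 x).
by apply: (@sub_ell p 1 w _ 1) => // x; rewrite mul1r.
Qed.

Lemma ell_subalgebra p w : 0 < p <= 1 -> is_weight w -> subalgebra (ell D A p w).
Proof.
move=> pp ww; have /andP[p0 p1] := pp; have [w0 _ wM] := powR_weight pp ww.
have sub1 := ell_sub_ell1 pp ww.
split => //.
- apply: (wsum_finite_support (J := [fset (0 : X)]%fset)) => // x.
  by rewrite inE /Defs.delta0 => /negPf ->.
- move=> f g fp gp; rewrite ellE.
  apply: (@le_lt_trans _ _ (wsum p (fun x => (w x `^ p)%R) (absf f \+ absf g)%E)).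
    apply: le_wsum => //; [exact: ltW|exact: absf_ge0|move=> x].
    by rewrite lee_fin rnormD.
  apply: le_lt_trans (wsumD pp w0 (absf_ge0 f) (absf_ge0 g)) _.
  exact: lte_add_pinfty.
- move=> c f fp; rewrite /ell/=.
  have c0 : 0 <= complex.Re `|c| by rewrite -lecR RRe_real ?normr_real ?normr_ge0.
  under eq_esum do rewrite rnormZ powRM ?rnorm_ge0// -mulrA EFinM.
  rewrite ge0_esumZl ?lee_fin ?powR_ge0//; last first.
    by move=> x; rewrite lee_fin mulr_ge0 ?powR_ge0.
  by apply: mule_lty => //; rewrite ?lee_fin ?powR_ge0 ?ltry.
- move=> f g fp gp; rewrite ellE.
  have /ell1E f1 := sub1 _ fp; have /ell1E g1 := sub1 _ gp.
  apply: (@le_lt_trans _ _ (wsum p (fun x => (w x `^ p)%R) (econv (absf g) (absf f)))).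
    apply: le_wsum => //; [exact: ltW|exact: absf_ge0|move=> x].
    exact: absf_conv_le.
  apply: le_lt_trans (wsum_econv pp w0 wM (absf_ge0 g) (absf_ge0 f)) _.
  by apply: mule_lty => //; exact: wsum_ge0.
Qed.

(** [f] and its inverse get separate weights: a constant family returns the inverse to the space of
    [f], while a family of smaller weights serves the union, where some decay is lost. *)
Lemma ell_inverse (I : Type) p w (wi : I -> X -> R) f g : 0 < p <= 1 ->
  is_weight w -> (forall i, is_weight (wi i)) -> (forall i x, wi i x <= w x) ->
  GRS wi -> ell D A p w f -> ell1 D A g ->
  conv f g = delta0 -> conv g f = delta0 -> exists i, ell D A p (wi i) g.
Proof.
move=> pp ww wwi wiw grs fp /ell1E g1 fg gf.
have /andP[p0 p1] := pp; have [w0 _ wM] := powR_weight pp ww.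
have /ell1E f1 := ell_sub_ell1 pp ww fp.
have wi0 i x : 0 <= wi i x by case: (wwi i) => w1 _; exact: le_trans (w1 x).
apply: (wiener (E := E) (w0 := fun x => w x `^ p)
    (w := fun i x => wi i x `^ p) _ pp w0 wM _ _ _ _ f1 fp g1 fg gf).
- exact: euclidD.
- by move=> i x; exact: powR_ge0.
- move=> i x; apply: ge0_ler_powR; rewrite ?nnegrE ?wi0// ?(ltW p0)//.
  exact: le_trans (wi0 i x) (wiw i x).
- by move=> i; have [] := powR_weight pp (wwi i).
- apply: subexponential_of_exp_bound => [x|d d0]; first exact: euclid_ge0.
  have [i [K K0 KP]] := grs d d0; exists i; exists K => // x.
  have [_ le_wi _] := powR_weight pp (wwi i).
  exact: le_trans (le_wi x) (KP x).
Qed.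

Lemma ell_inverse_closed p w : 0 < p <= 1 -> is_weight w ->
  GRS (fun _ : unit => w) -> inverse_closed (ell D A p w).
Proof.
move=> pp ww grs; split=> [|f fp [g g1 [fg gf]]]; first exact: ell_subalgebra.
have [_ gp] := ell_inverse pp ww (fun=> ww) (fun _ _ => lexx _) grs fp g1 fg gf.
by exists g.
Qed.

End WeightedSpaces.

(** * Inclusions between the spaces, and their unions and intersections *)

Section Hierarchy.
Context {R : realType} {D : lattice_rank} {A : banachAlgType R[i]}.
Local Notation X := (lattice D).
Local Notation E := (@euclid R D).
Implicit Types (a b p s : R).

Lemma weight_ge0 (w : X -> R) : is_weight w -> forall x, 0 <= w x.
Proof. by move=> [w1 _] x; exact: le_trans (w1 x). Qed.

Lemma eta_le_nu a b (n : nat) : 0 < a -> 0 < b < 1 ->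
  exists2 K, 0 <= K & forall x : X, eta_weight a b x <= K * nu_weight n%:R x.
Proof.
move=> a0 b01; have n1 : 0 < (n%:R + 1)^-1 :> R.
  by rewrite invr_gt0 ltr_wpDl.
have [C C0 CP] := powR_le_linear a0 b01 n1.
exists (expR C) => [|x]; first exact: expR_ge0.
by rewrite -expRD ler_expR addrC [_ / _]mulrC CP ?euclid_ge0.
Qed.

(** Since (1 + t)^b <= 1 + t^b, the polynomial weight is at most (1 + t^b)^(s/b), and powers of 1 +
    t^b are dominated by exp(a t^b). *)
Lemma omega_le_eta a b s : 0 < a -> 0 < b < 1 -> 0 <= s ->
  exists2 K, 0 <= K & forall x : X, omega_weight s x <= K * eta_weight a b x.
Proof.
move=> a0 /andP[b0 b1] s0; have sb0 : 0 <= s / b by rewrite divr_ge0// ltW.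
have [C C0 CP] := poly_le_exp sb0 a0.
exists C => // x; have E0 := euclid_ge0 (R := R) x.
apply: le_trans (CP (E x `^ b) (powR_ge0 _ _)).
have -> : omega_weight s x = ((1 + E x) `^ b) `^ (s / b).
  by rewrite -powRrM mulrCA divff ?mulr1// gt_eqF.
apply: ge0_ler_powR; rewrite ?nnegrE ?addr_ge0 ?powR_ge0//.
by apply: le_trans (powRD_le _ _ _) _ => //; rewrite ?b0 ?(ltW b1)// powR1.
Qed.

Lemma omega_mono s t (x : X) : s <= t -> omega_weight s x <= omega_weight t x.
Proof. by move=> st; apply: ler_powR => //; rewrite lerDl euclid_ge0. Qed.

Lemma sub_ell_nu (q_ : nat -> R) (m n : nat) : (forall n, (0 < n)%N -> 0 < q_ n <= 1) ->
  (forall m n, (0 < m)%N -> (m <= n)%N -> q_ m <= q_ n) ->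
  (0 < m)%N -> (m <= n)%N ->
  ell D A (q_ m) (nu_weight m%:R) `<=` ell D A (q_ n) (nu_weight n%:R).
Proof.
move=> q01 q_incr m0 mn; have /andP[qm0 _] := q01 m m0.
apply: (@sub_ell _ _ _ _ _ _ _ 1) => // [|x|x|x].
- exact: q_incr.
- exact/weight_ge0/nu_weightP.
- exact/weight_ge0/nu_weightP.
- by rewrite mul1r nu_weight_antimono.
Qed.

(** Along an increasing family two elements share a member, which gives the algebra operations. For
    inverses, a larger index pays for the lost decay. *)
Lemma E_space_inverse_closed (q_ : nat -> R) : (forall n, (0 < n)%N -> 0 < q_ n <= 1) ->
  (forall m n, (0 < m)%N -> (m <= n)%N -> q_ m <= q_ n) ->
  inverse_closed (E_space D A q_).
Proof.
move=> q01 q_incr; have mono := sub_ell_nu q01 q_incr.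
have nuP n := nu_weightP (D := D) (ler0n R n).
have alg n (n0 : (0 < n)%N) := ell_subalgebra (A := A) (q01 n n0) (nuP n).
have join f g : E_space D A q_ f -> E_space D A q_ g -> exists2 n, (0 < n)%N &
    ell D A (q_ n) (nu_weight n%:R) f /\ ell D A (q_ n) (nu_weight n%:R) g.
  move=> [m m0 fm] [n n0 gn]; exists (maxn m n); first by rewrite leq_max m0.
  by split; [apply: mono fm|apply: mono gn] => //; rewrite ?leq_maxl ?leq_maxr.
split.
  split.
  - by move=> f [n n0 fn]; have [sub _ _ _ _] := alg n n0; exact: sub.
  - by exists 1%N => //; have [_ h _ _ _] := alg 1%N isT.
  - move=> f g fE gE; have [n n0 [fn gn]] := join _ _ fE gE.
    by exists n => //; have [_ _ h _ _] := alg n n0; exact: h.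
  - move=> c f [n n0 fn].
    by exists n => //; have [_ _ _ h _] := alg n n0; exact: h.
  - move=> f g fE gE; have [n n0 [fn gn]] := join _ _ fE gE.
    by exists n => //; have [_ _ _ _ h] := alg n n0; exact: h.
move=> f [m m0 fm] [g g1 [fg gf]].
have [i x|i gi] := ell_inverse (wi := fun i => nu_weight (m + i)%:R)
    (q01 m m0) (nuP m) (fun i => nuP (m + i)%N) _ (nu_GRS m) fm g1 fg gf.
  by rewrite nu_weight_antimono ?leq_addr.
exists g => //; exists (m + i)%N; first by rewrite /= addn_gt0 m0.
have /andP[qm0 _] := q01 m m0.
(* The inverse was found with the exponent of index m and the weight of index m + i; the exponent is
   now raised to match. *)
apply: (sub_ell (K := 1) qm0 _ _ _ _ _ gi) => // [|x|x|x].
- by rewrite q_incr ?leq_addr.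
- exact/weight_ge0/nuP.
- exact/weight_ge0/nuP.
- by rewrite mul1r.
Qed.

Lemma ell_omega_inverse_closed p s : 0 < p <= 1 -> 0 <= s ->
  inverse_closed (ell D A p (omega_weight s)).
Proof.
by move=> pp s0; apply: ell_inverse_closed; [|exact: omega_weightP|exact: omega_GRS].
Qed.

Lemma S_space_inverse_closed (p_ : nat -> R) : (forall n, (0 < n)%N -> 0 < p_ n <= 1) ->
  inverse_closed (S_space D A p_).
Proof.
move=> p01; have closed n (n0 : (0 < n)%N) :=
  ell_omega_inverse_closed (p01 n n0) (ler0n R n).
split.
  split.
  - by move=> f fS; have [[sub _ _ _ _] _] := closed 1%N isT; exact/sub/fS.
  - by move=> n n0; have [[_ h _ _ _] _] := closed n n0.
  - move=> f g fS gS n n0; have [[_ _ h _ _] _] := closed n n0.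
    by apply: h; [exact: fS|exact: gS].
  - move=> c f fS n n0; have [[_ _ _ h _] _] := closed n n0.
    by apply: h; exact: fS.
  - move=> f g fS gS n n0; have [[_ _ _ _ h] _] := closed n n0.
    by apply: h; [exact: fS|exact: gS].
move=> f fS [g g1 [fg gf]]; exists g => // n n0.
have fn := fS n n0.
have [_ gn] := ell_inverse (p01 n n0) (omega_weightP (ler0n R n))
  (fun=> omega_weightP (ler0n R n)) (fun _ _ => lexx _)
  (omega_GRS (ler0n R n)) fn g1 fg gf.
exact: gn.
Qed.

End Hierarchy.

Theorem theorem5p4 (R : realType) (D : lattice_rank) (D_gt0 : positive_rank D)
    (A : banachAlgType R[i]) (a b p : R) (p_ q_ s_ : nat -> R)
    (a_gt0 : 0 < a) (b01 : 0 < b < 1)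
    (p01 : forall n, (0 < n)%N -> 0 < p_ n <= 1)
    (q01 : forall n, (0 < n)%N -> 0 < q_ n <= 1)
    (p_decr : forall m n, (0 < m)%N -> (m <= n)%N -> p_ n <= p_ m)
    (q_incr : forall m n, (0 < m)%N -> (m <= n)%N -> q_ m <= q_ n)
    (qpp : forall n, (0 < n)%N -> q_ n <= p <= p_ n)
    (s_bnd : forall n, (0 < n)%N -> n%:R - 1 < s_ n <= n%:R) :
  [/\ E_space D A q_ `<=` ell D A p (eta_weight a b),
      ell D A p (eta_weight a b) `<=` S_space D A p_,
      forall n, (0 < n)%N -> S_space D A p_ `<=` ell D A (p_ n) (omega_weight (s_ n)),
      forall n, (0 < n)%N ->
        ell D A (p_ n) (omega_weight (s_ n)) `<=`
        ell D A (p_ 1%N) (omega_weight (s_ 1%N)) &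
      ell D A (p_ 1%N) (omega_weight (s_ 1%N)) `<=` ell1 D A] /\
  [/\ inverse_closed (E_space D A q_),
      inverse_closed (ell D A p (eta_weight a b)),
      inverse_closed (S_space D A p_),
      forall n, (0 < n)%N ->
        inverse_closed (ell D A (p_ n) (omega_weight (s_ n))) &
      inverse_closed (ell1 D A)].
Proof.
have s0 n : (0 < n)%N -> 0 <= s_ n.
  move=> n0; have /andP[/ltW lo _] := s_bnd n n0; apply: le_trans lo.
  by rewrite subr_ge0 ler1n.
have p0 : 0 < p.
  by have /andP[q1 _] := q01 1%N isT; have /andP[qp _] := qpp 1%N isT; exact: lt_le_trans qp.
have pp : 0 < p <= 1.
  have /andP[_ p1] := p01 1%N isT; have /andP[_ pp1] := qpp 1%N isT.
  by rewrite p0 (le_trans pp1).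
have om0 s : 0 <= s -> forall x : lattice D, 0 <= omega_weight s x.
  by move=> s_ge0; exact/weight_ge0/omega_weightP.
have eta0 : forall x : lattice D, 0 <= eta_weight a b x.
  exact/weight_ge0/eta_weightP.
split; split.
- move=> f [n n0]; have [K K0 KP] := eta_le_nu (D := D) n a_gt0 b01.
  have /andP[qn0 _] := q01 n n0; have /andP[qp _] := qpp n n0.
  apply: (sub_ell qn0 qp K0) => //.
  exact/weight_ge0/nu_weightP.
- move=> f fp n n0; have [K K0 KP] := omega_le_eta (D := D) a_gt0 b01 (ler0n R n).
  have /andP[_ ppn] := qpp n n0.
  by apply: (sub_ell p0 ppn K0 _ _ KP) fp => //; exact: om0.
- move=> n n0 f /(_ n n0); have /andP[pn0 _] := p01 n n0.
  have /andP[_ sn] := s_bnd n n0.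
  apply: (sub_ell (K := 1) pn0 (lexx _)) => // [||x].
  + exact: om0.
  + exact/om0/s0.
  + by rewrite mul1r omega_mono.
- move=> n n0; have /andP[pn0 _] := p01 n n0.
  apply: (sub_ell (K := 1) pn0 (p_decr 1%N n isT n0)) => // [||x].
  + exact/om0/s0.
  + exact/om0/s0.
  (* For n = 1 the exponents coincide; for n >= 2, s_1 <= 1 <= n - 1 < s_n. *)
  + rewrite mul1r omega_mono//; case: n n0 {pn0} => [//|[//|n]] _.
    have /andP[_ s1] := s_bnd 1%N isT; apply: (le_trans s1).
    have /andP[/ltW lo _] := s_bnd n.+2 isT; apply: le_trans lo.
    by rewrite lerBrDr -[1 + 1]/(2%:R) ler_nat.
- exact: ell_sub_ell1 (p01 1%N isT) (omega_weightP (s0 1%N isT)).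
- exact: E_space_inverse_closed.
- by apply: ell_inverse_closed => //; [exact: eta_weightP|exact: eta_GRS].
- exact: S_space_inverse_closed.
- by move=> n n0; exact: ell_omega_inverse_closed (p01 n n0) (s0 n n0).
(* The case of exponent 1 and constant weight 1, whose growth condition holds with K = 1. *)
- apply: ell_inverse_closed; rewrite ?ltr01 ?lexx//.
    by split=> // x y; rewrite mulr1.
  move=> d d0; exists tt; exists 1 => // x.
  by rewrite mul1r -[leLHS]expR0 ler_expR mulr_ge0 ?euclid_ge0 ?ltW.
Qed.
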